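(* Let $\mathbb{K}$ be an algebraically closed field of characteristic zero and let $\mathfrak{g}$ be a finite-dimensional Lie algebra over $\mathbb{K}$. If $\mathfrak{g}$ is strongly rigid, then $\mathfrak{g}$ is rigid as a Lie algebra.
   Context: A formal associative (resp. Lie) deformation of an associative (resp. Lie) $\mathbb{K}$-algebra $(\mathcal{A},\mu_0)$ is an associative (resp. Lie) $\mathbb{K}[[t]]$-bilinear product $\mu_t=\mu_0+t\mu_1+t^2\mu_2+\cdots$ on $\mathcal{A}[[t]]$ with $\mu_r\in\mathrm{Hom}_{\mathbb{K}}(\mathcal{A}\otimes\mathcal{A},\mathcal{A})$ (resp. $\mathrm{Hom}_{\mathbb{K}}(\Lambda^2\mathcal{A},\mathcal{A})$). Two deformations $\mu_t,\mu_t'$ are equivalent if there is $\varphi_t=\mathrm{Id}+t\varphi_1+t^2\varphi_2+\cdots$ with $\varphi_r\in\mathrm{Hom}_{\mathbb{K}}(\mathcal{A},\mathcal{A})$ and $\mu_t'(a,b)=\varphi_t^{-1}(\mu_t(\varphi_t(a),\varphi_t(b)))$ for all $a,b\in\mathcal{A}$. A deformation is trivial if it is equivalent to $\mu_0$. The algebra $\mathcal{A}$ is rigid (as an associative, resp. Lie, algebra) if every formal associative (resp. Lie) deformation of it is trivial. A Lie algebra $\mathfrak{g}$ is strongly rigid if its universal enveloping algebra $\mathcal{U}\mathfrak{g}$ is rigid as an associative algebra. *)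

(* Defs.v *)
From HB Require Import structures.
From mathcomp Require Import all_boot all_algebra.
From mathcomp Require Import boolp.

Set Implicit Arguments.
Unset Strict Implicit.
Unset Printing Implicit Defensive.

Import GRing.Theory.
Local Open Scope ring_scope.

Section Products.
Variables (K : fieldType) (A : lmodType K).

Definition bilinear_map (mu : A -> A -> A) : Prop :=
  (forall a, linear (mu a)) /\ (forall b, linear (mu^~ b)).

Definition alternating (mu : A -> A -> A) : Prop := forall a, mu a a = 0.

Definition jacobi (mu : A -> A -> A) : Prop :=
  forall a b c, mu a (mu b c) + mu b (mu c a) + mu c (mu a b) = 0.

Definition lie_bracket (mu : A -> A -> A) : Prop :=
  [/\ bilinear_map mu, alternating mu & jacobi mu].

End Products.

(* The formal series sum_n t^n a_n of A[[t]] is the sequence a : nat -> A, and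
   equality of series is pointwise equality.  A family mu : nat -> A -> A -> A
   of bilinear maps stands for mu_t = sum_r t^r mu_r, and a family
   phi : nat -> A -> A of linear maps for phi_t = sum_r t^r phi_r. *)
Section Deformations.
Variables (K : fieldType) (A : lmodType K).
Implicit Types (mu : nat -> A -> A -> A) (phi : nat -> A -> A).

(* The K[[t]]-bilinear extension of mu_t to A[[t]]. *)
Definition series_mul mu (a b : nat -> A) : nat -> A := fun n =>
  \sum_(i < n.+1) \sum_(j < n.+1) \sum_(k < n.+1 | (i + j + k == n)%N)
    mu i (a j) (b k).

(* The K[[t]]-linear extension of phi_t to A[[t]]. *)
Definition series_app phi (a : nat -> A) : nat -> A := fun n =>
  \sum_(i < n.+1) \sum_(j < n.+1 | (i + j == n)%N) phi i (a j).

Definition assoc_deformation (mu0 : A -> A -> A) mu : Prop :=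
  [/\ mu 0%N =2 mu0,
      forall r, bilinear_map (mu r) &
      forall a b c : nat -> A,
        series_mul mu (series_mul mu a b) c
          =1 series_mul mu a (series_mul mu b c)].

Definition lie_deformation (mu0 : A -> A -> A) mu : Prop :=
  [/\ mu 0%N =2 mu0,
      forall r, bilinear_map (mu r) /\ alternating (mu r),
      forall a : nat -> A, series_mul mu a a =1 (fun=> 0) &
      forall a b c : nat -> A,
        (fun n => series_mul mu a (series_mul mu b c) n
                + series_mul mu b (series_mul mu c a) n
                + series_mul mu c (series_mul mu a b) n) =1 (fun=> 0)].

(* psi is the inverse of phi_t on A[[t]]; it is determined by phi_t. *)
Definition equivalent_deformations mu mu' : Prop :=
  exists (phi : nat -> A -> A) (psi : (nat -> A) -> (nat -> A)),
    [/\ phi 0%N =1 id,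
        forall r, linear (phi r),
        forall a, psi (series_app phi a) =1 a /\ series_app phi (psi a) =1 a &
        forall a b : A,
          (fun n => mu' n a b)
            =1 psi (series_mul mu (fun n => phi n a) (fun n => phi n b))].

Definition constant_deformation (mu0 : A -> A -> A) : nat -> A -> A -> A :=
  fun r => if r is 0%N then mu0 else fun _ _ => 0.

Definition trivial_deformation (mu0 : A -> A -> A) mu : Prop :=
  equivalent_deformations mu (constant_deformation mu0).

Definition assoc_rigid (mu0 : A -> A -> A) : Prop :=
  forall mu, assoc_deformation mu0 mu -> trivial_deformation mu0 mu.

Definition lie_rigid (mu0 : A -> A -> A) : Prop :=
  forall mu, lie_deformation mu0 mu -> trivial_deformation mu0 mu.

End Deformations.

Section Enveloping.
Variables (K : fieldType) (g : lmodType K) (br : g -> g -> g).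

Definition lie_morphism (A : algType K) (f : g -> A) : Prop :=
  linear f /\ forall x y, f (br x y) = f x * f y - f y * f x.

(* (U, iota) is the universal enveloping algebra of (g, br).  An algType is a
   nonzero ring, but this is no restriction: the universal property for the
   zero algebra is automatic. *)
Definition universal_enveloping (U : algType K) (iota : g -> U) : Prop :=
  lie_morphism iota /\
  forall (A : algType K) (f : g -> A), lie_morphism f ->
    exists F : {lrmorphism U -> A},
      (forall x, F (iota x) = f x) /\
      (forall F' : {lrmorphism U -> A},
         (forall x, F' (iota x) = f x) -> F' =1 F).

(* The enveloping algebra is unique up to isomorphism, and it exists by
   universal_enveloping_exists below. *)
Definition strongly_rigid : Prop :=
  exists (U : algType K) (iota : g -> U),
    universal_enveloping iota /\ @assoc_rigid K U *%R.

End Enveloping.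

(* Existence: noncommutative polynomial expressions in the elements of g,
   modulo the identities that hold under every Lie morphism to an algebra. *)
Module EnvelopingConstruction.
Section Construction.
Variables (K : fieldType) (g : lmodType K) (br : g -> g -> g).

Inductive term :=
  | Cst of K
  | Gen of g
  | Add of term & term
  | Mul of term & term.

HB.instance Definition _ := gen_eqMixin term.
HB.instance Definition _ := gen_choiceMixin term.

Fixpoint eval (A : algType K) (f : g -> A) (s : term) : A :=
  match s with
  | Cst c => c%:A
  | Gen x => f x
  | Add s1 s2 => eval f s1 + eval f s2
  | Mul s1 s2 => eval f s1 * eval f s2
  end.

Definition same (s1 s2 : term) : Prop :=
  forall (A : algType K) (f : g -> A), lie_morphism br f ->
    eval f s1 = eval f s2.

Definition sameb s1 s2 := `[< same s1 s2 >].

Lemma sameb_refl : reflexive sameb.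
Proof. by move=> s; apply/asboolP. Qed.

Lemma sameb_sym : symmetric sameb.
Proof. by move=> s1 s2; apply/asboolP/asboolP => H A f Hf; rewrite H. Qed.

Lemma sameb_trans : transitive sameb.
Proof.
move=> s2 s1 s3 /asboolP H12 /asboolP H23; apply/asboolP => A f Hf.
by rewrite H12 // H23.
Qed.

Canonical sameb_equiv := EquivRel sameb sameb_refl sameb_sym sameb_trans.

Definition env := {eq_quot sameb_equiv}%qT.
HB.instance Definition _ := Choice.on env.

Definition cls (s : term) : env := (\pi_env s)%qT.
Definition rep (u : env) : term := repr u.

Lemma repK u : cls (rep u) = u.
Proof. exact: reprK. Qed.

Lemma clsP s1 s2 : same s1 s2 -> cls s1 = cls s2.
Proof. by move=> H; apply/eqmodP/asboolP. Qed.

Lemma rep_cls s : same (rep (cls s)) s.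
Proof.
have /eqmodP/asboolP : cls (rep (cls s)) = cls s by exact: reprK.
by [].
Qed.

Definition eadd u v := cls (Add (rep u) (rep v)).
Definition eopp u := cls (Mul (Cst (-1)) (rep u)).
Definition emul u v := cls (Mul (rep u) (rep v)).
Definition escale c u := cls (Mul (Cst c) (rep u)).

Lemma env_eq u v : same (rep u) (rep v) -> u = v.
Proof. by move=> H; rewrite -[u]repK -[v]repK; apply: clsP. Qed.

Ltac env_tac :=
  repeat intro; apply: env_eq => B h Hh;
  rewrite /eadd /eopp /emul /escale; do !rewrite rep_cls //=;
  rewrite ?mulr_algl ?scaleN1r ?scale0r ?scale1r.

Lemma eaddA : associative eadd. Proof. by env_tac; rewrite addrA. Qed.
Lemma eaddC : commutative eadd. Proof. by env_tac; rewrite addrC. Qed.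
Lemma eadd0 : left_id (cls (Cst 0)) eadd.
Proof. by env_tac; rewrite add0r. Qed.
Lemma eaddN : left_inverse (cls (Cst 0)) eopp eadd.
Proof. by env_tac; rewrite addNr. Qed.

HB.instance Definition _ :=
  GRing.isZmodule.Build env eaddA eaddC eadd0 eaddN.

Lemma emulA : associative emul. Proof. by env_tac; rewrite mulrA. Qed.
Lemma emul1l : left_id (cls (Cst 1)) emul.
Proof. by env_tac. Qed.
Lemma emul1r : right_id (cls (Cst 1)) emul.
Proof. by env_tac; rewrite mulr1. Qed.
Lemma emulDl : left_distributive emul eadd.
Proof. by env_tac; rewrite mulrDl. Qed.
Lemma emulDr : right_distributive emul eadd.
Proof. by env_tac; rewrite mulrDr. Qed.

Lemma zero_lie_morphism : lie_morphism br (fun _ : g => 0 : K^o).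
Proof. by split=> [c x y|x y]; rewrite ?scaler0 ?mulr0 ?subr0 ?addr0. Qed.

Lemma eone_neq0 : cls (Cst 1) != cls (Cst 0).
Proof.
apply/eqP => /eqmodP/asboolP/(_ _ _ zero_lie_morphism) /=.
by move/eqP; rewrite scale1r scale0r oner_eq0.
Qed.

HB.instance Definition _ := GRing.Zmodule_isNzRing.Build env
  emulA emul1l emul1r emulDl emulDr eone_neq0.

Lemma escaleA c d u : escale c (escale d u) = escale (c * d) u.
Proof. by env_tac; rewrite scalerA. Qed.
Lemma escale1 : left_id 1 escale. Proof. by env_tac. Qed.
Lemma escaleDr : right_distributive escale +%R.
Proof.
move=> c u v; change (escale c (eadd u v) = eadd (escale c u) (escale c v)).
by env_tac; rewrite scalerDr.
Qed.
Lemma escaleDl u : {morph escale^~ u : c d / c + d}.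
Proof.
move=> c d; change (escale (c + d) u = eadd (escale c u) (escale d u)).
by env_tac; rewrite scalerDl.
Qed.

HB.instance Definition _ := GRing.Zmodule_isLmodule.Build K env
  escaleA escale1 escaleDr escaleDl.

Lemma escaleAl c (u v : env) : c *: (u * v) = c *: u * v.
Proof.
change (escale c (emul u v) = emul (escale c u) v).
by env_tac; rewrite scalerAl.
Qed.

HB.instance Definition _ := GRing.Lmodule_isLalgebra.Build K env escaleAl.

Lemma escaleAr c (u v : env) : c *: (u * v) = u * (c *: v).
Proof.
change (escale c (emul u v) = emul u (escale c v)).
by env_tac; rewrite scalerAr.
Qed.

HB.instance Definition _ := GRing.Lalgebra_isAlgebra.Build K env escaleAr.

Definition gen (x : g) : env := cls (Gen x).

Lemma gen_lie_morphism : lie_morphism br gen.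
Proof.
split=> [c x y|x y].
  change (gen (c *: x + y) = eadd (escale c (gen x)) (gen y)).
  by env_tac; case: Hh => ->.
change (gen (br x y) = eadd (emul (gen x) (gen y)) (eopp (emul (gen y) (gen x)))).
by env_tac; case: Hh => _ ->.
Qed.

Section Lift.
Variables (A : algType K) (f : g -> A) (Hf : lie_morphism br f).

Definition lift (u : env) : A := eval f (rep u).

Lemma lift_linear : linear lift.
Proof.
move=> c u v; change (lift (eadd (escale c u) v) = c *: lift u + lift v).
by rewrite /lift; do !rewrite rep_cls //=; rewrite mulr_algl.
Qed.

Lemma lift_monoid : monoid_morphism lift.
Proof.
split; first by change (lift (cls (Cst 1)) = 1); rewrite /lift rep_cls //= scale1r.
by move=> u v; change (lift (emul u v) = lift u * lift v); rewrite /lift rep_cls.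
Qed.

HB.instance Definition _ := GRing.isLinear.Build K env A _ lift lift_linear.
HB.instance Definition _ :=
  GRing.isMonoidMorphism.Build env A lift lift_monoid.

Definition lift_lrmorphism : {lrmorphism env -> A} := lift.

End Lift.

Lemma cls_eval (A : algType K) (F : {lrmorphism env -> A}) s :
  F (cls s) = eval (F \o gen) s.
Proof.
elim: s => [c|x|s1 IH1 s2 IH2|s1 IH1 s2 IH2] //=.
- have -> : cls (Cst c) = c *: 1.
    change (cls (Cst c) = escale c (cls (Cst 1))).
    by env_tac.
  by rewrite linearZ rmorph1.
- rewrite -IH1 -IH2 -rmorphD; congr (F _).
  by change (cls (Add s1 s2) = eadd (cls s1) (cls s2)); env_tac.
- rewrite -IH1 -IH2 -rmorphM; congr (F _).
  by change (cls (Mul s1 s2) = emul (cls s1) (cls s2)); env_tac.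
Qed.

Lemma eq_eval (A : algType K) (f f' : g -> A) : f =1 f' -> eval f =1 eval f'.
Proof. by move=> E; elim=> //= s1 -> s2 ->. Qed.

Lemma gen_universal : universal_enveloping br gen.
Proof.
split; first exact: gen_lie_morphism.
move=> A f Hf; exists (lift_lrmorphism Hf); split=> [x|F' HF' u].
  by rewrite /= /lift rep_cls.
by rewrite -[u in F' u]repK cls_eval /= /lift; apply: eq_eval.
Qed.

End Construction.
End EnvelopingConstruction.

Lemma universal_enveloping_exists (K : fieldType) (g : lmodType K)
    (br : g -> g -> g) :
  exists (U : algType K) (iota : g -> U), universal_enveloping br iota.
Proof.
by eexists; eexists; apply: EnvelopingConstruction.gen_universal.
Qed.

(* Main.v *)
Require Import Defs.
From HB Require Import structures.
From mathcomp Require Import all_boot all_algebra.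
From mathcomp Require Import boolp functions zify.

(* Let mu_t be a Lie deformation of g, conjugated so that mu_t = br + t^q mu_q + ...
   By the Poincare-Birkhoff-Witt theorem over K[[t]], the enveloping algebra of
   (g[[t]], mu_t) is an associative deformation m_t of U = U(g) with
   m_t = m_0 + t^q m_q + ... and m_q(x, y) - m_q(y, x) = mu_q(x, y) on g.  By
   strong rigidity some Phi_t trivializes it, and the coefficient D of t^q in
   Phi^-1 (t d/dt) Phi satisfies D(uv) = D(u) v + u D(v) + q m_q(u, v).  Hence
   q mu_q is the coboundary of D restricted to g, with values in U.  A linear
   retraction U -> g commuting with ad(g) turns D into a cochain with values in
   g; it is the spectral projection onto the eigenvalue 2 of the Adams operation
   psi (convolution square of the identity), as psi = 2^d on the d-th graded
   piece of U.  So mu_q is a coboundary in characteristic 0 and can be removed;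
   repeating this for all q gives an equivalence of mu_t with br. *)

Set Implicit Arguments.
Unset Strict Implicit.
Unset Printing Implicit Defensive.

Import GRing.Theory.
Local Open Scope ring_scope.

(** * Straightening of words *)

(** The algebra over K[[t]] enters only through its multiplication table on U[[t]], where U is
    identified with the span of the nondecreasing words: relations of mu_t rewrite a word into
    nondecreasing ones, and concatenation becomes the product. Everything rests on confluence of
    this rewriting, so the diamond lemma is proved for functions on words with values in an abelian
    group with commuting operators. Scalars of K give the theorem for U, power series acting on
    U[[t]] give it for mu_t. The obstacle is that U is infinite-dimensional and known through a
    universal property that yields algebra morphisms; linear maps out of U come from modules
    instead. The cochain D takes values in U, but g is finite-dimensional, so D(g) involves words of
    bounded length only, and finitely many factors psi - 2^k give the projection there.
    Characteristic zero makes q and the numbers 2 - 2^k nonzero. *)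

Section Straightening.
Variable n : nat.
Implicit Types (u v w : seq 'I_n) (i j k : 'I_n).

Definition nondecreasing w := sorted (fun i j => (i <= j)%N) w.

Fixpoint first_descent w : option (seq 'I_n * 'I_n * 'I_n * seq 'I_n) :=
  match w with
  | [::] => None
  | i :: w' =>
    match w' with
    | [::] => None
    | j :: v =>
      if (j < i)%N then Some ([::], i, j, v)
      else omap (fun d => let: (u, a, b, v) := d in (i :: u, a, b, v))
             (first_descent w')
    end
  end.

Lemma first_descent_cons i j v : first_descent (i :: j :: v) =
  if (j < i)%N then Some ([::], i, j, v)
  else omap (fun d => let: (u, a, b, v) := d in (i :: u, a, b, v))
         (first_descent (j :: v)).
Proof. by []. Qed.

Lemma first_descentN w : first_descent w = None -> nondecreasing w.
Proof.
elim: w => [//|i [//|j v] IH]; rewrite first_descent_cons; case: ltnP => // le_ij.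
case E: (first_descent _) => // _.
by rewrite /nondecreasing /= le_ij; apply: IH.
Qed.

Lemma first_descentS w u i j v : first_descent w = Some (u, i, j, v) ->
  w = u ++ i :: j :: v /\ (j < i)%N.
Proof.
elim: w u => [//|a [//|b w] IH] u; rewrite first_descent_cons.
case: ltnP => [lt_ba [<- <- <- <-] //|_].
case E: (first_descent _) => [[[[u' a'] b'] v']|] //= [<- Ea Eb Ev].
by move: E; rewrite Ea Eb Ev => /IH[-> ->].
Qed.

(** The critical pairs of the rewriting: a given descent is the first one, shares the second letter
    of the first one, or lies entirely to its right. *)
Lemma first_descentP u i j v : (j < i)%N ->
  exists u0 i0 j0 v0,
    first_descent (u ++ i :: j :: v) = Some (u0, i0, j0, v0) /\
    [\/ [/\ u = u0, i = i0, j = j0 & v = v0],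
        [/\ u = rcons u0 i0, i = j0 & v0 = j :: v] |
        exists u2, u = u0 ++ i0 :: j0 :: u2 /\ v0 = u2 ++ i :: j :: v].
Proof.
move=> lt_ji; elim: u => [|a u [u0 [i0 [j0 [v0 [E H]]]]]].
  by exists [::], i, j, v; rewrite /= lt_ji; split=> //; constructor 1.
have [b [w Ew]] : exists b w, u ++ i :: j :: v = b :: w.
  by case: (u) => [|b u']; [exists i, (j :: v)|exists b, (u' ++ i :: j :: v)].
rewrite cat_cons Ew first_descent_cons; case: ltnP => [lt_ba|le_ab].
  exists [::], a, b, w; split=> //; case: (u) Ew => [|c u'] /=.
    by case=> <- <-; constructor 2.
  by case=> <- <-; constructor 3; exists u'.
rewrite -Ew E /=; exists (a :: u0), i0, j0, v0; split=> //.
case: H => [[-> -> -> ->]|[-> -> ->]|[u2 [-> ->]]]; first by constructor 1.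
  by constructor 2.
by constructor 3; exists u2.
Qed.

Fixpoint weight w : nat := if w is i :: w' then (i * size w' + weight w')%N else 0.

(** Termination order. Exchanging a descent lowers [weight], where the index of a letter counts once
    for each letter to its right; as [weight w] is at most n times the squared length, the cubic
    term makes the loss of a letter outweigh any change of [weight]. *)
Definition measure w := (n * size w ^ 3 + weight w)%N.

Lemma weight_le w : (weight w <= n * size w ^ 2)%N.
Proof. by elim: w => [//|i w IH] /=; have := ltn_ord i; nia. Qed.

Lemma weight_swap u i j v : (j < i)%N ->
  (weight (u ++ j :: i :: v) < weight (u ++ i :: j :: v))%N.
Proof.
move=> lt_ji; elim: u => [|a u IH] /=; first by nia.
by rewrite !size_cat /= ltn_add2l.
Qed.

Lemma measure_swap u i j v : (j < i)%N ->
  (measure (u ++ j :: i :: v) < measure (u ++ i :: j :: v))%N.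
Proof. by move=> lt_ji; rewrite /measure !size_cat /= ltn_add2l weight_swap. Qed.

Lemma measure_short w w' : (size w < size w')%N -> (measure w < measure w')%N.
Proof.
case: w' => [//|i w'] /=; rewrite ltnS => lt_ww'.
have n0 : (0 < n)%N := leq_trans (ltn0Sn i) (ltn_ord i).
rewrite /measure /=; apply: leq_trans (leq_addr _ _).
apply: (@leq_ltn_trans (n * (size w ^ 2 * (size w).+1))).
  by have := weight_le w; nia.
rewrite ltn_pmul2l // (expnSr _ 2).
apply: (@leq_ltn_trans (size w ^ 2 * (size w').+1)).
  by rewrite leq_mul2l ltnS lt_ww' orbT.
by rewrite ltn_pmul2r // ltn_sqr ltnS.
Qed.

Lemma measure_contract u i j k v :
  (measure (u ++ k :: v) < measure (u ++ i :: j :: v))%N.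
Proof. by apply: measure_short; rewrite !size_cat /=; lia. Qed.

Lemma straightening_ind (P : seq 'I_n -> Prop) :
    (forall w, nondecreasing w -> P w) ->
    (forall u i j v, (j < i)%N -> P (u ++ j :: i :: v) ->
       (forall k, P (u ++ k :: v)) -> P (u ++ i :: j :: v)) ->
  forall w, P w.
Proof.
move=> Ps Pd w; have [m] := ubnP (measure w); elim: m w => // m IH w le_wm.
case E: (first_descent w) => [[[[u i] j] v]|]; last first.
  exact/Ps/first_descentN.
have [Ew lt_ji] := first_descentS E; rewrite Ew in le_wm *.
apply: Pd => // [|k]; apply: IH.
  exact: leq_trans (measure_swap _ _ lt_ji) le_wm.
exact: leq_trans (measure_contract _ _ _ _ _) le_wm.
Qed.

(** * Normal forms of words and confluence *)

Section Compatible.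
Variables (M : zmodType) (C : 'I_n -> 'I_n -> 'I_n -> {additive M -> M}).
Implicit Type h : seq 'I_n -> M.

(** The pair i j is replaced by its bracket. The coefficients are operators on M so that one theory
    covers scalars of K and multiplication by power series. *)
Definition contract h u i j v : M := \sum_k C i j k (h (u ++ k :: v)).

(* h kills the two-sided ideal generated by the relations
   e_i e_j - e_j e_i = [e_i, e_j], where the C i j k are the structure
   constants of the bracket. *)
Definition compatible h := forall u i j v,
  h (u ++ i :: j :: v) - h (u ++ j :: i :: v) = contract h u i j v.

Lemma compatible_eq h h' : compatible h -> compatible h' ->
  (forall w, nondecreasing w -> h w = h' w) -> h =1 h'.
Proof.
move=> hc hc' E; elim/straightening_ind => // u i j v _ IH1 IH2.
apply/(addIr (- h (u ++ j :: i :: v))); rewrite hc IH1 hc'.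
by apply: eq_bigr => k _; rewrite IH2.
Qed.

Hypothesis C_alt : forall i k x, C i i k x = 0.
Hypothesis C_anti : forall i j k x, C i j k x = - C j i k x.
Hypothesis C_comm : forall i j k i' j' k' x,
  C i j k (C i' j' k' x) = C i' j' k' (C i j k x).
Hypothesis C_jacobi : forall i j l p x,
  \sum_m (C j l m (C i m p x) + C l i m (C j m p x) + C i j m (C l m p x)) = 0.

Variable h0 : seq 'I_n -> M.

(** The recursion descends along [measure], hence the fuel; the value 0 on empty fuel is never
    reached from [straighten]. *)
Fixpoint straighten_fuel d w : M :=
  if d is d'.+1 then
    if first_descent w is Some (u, i, j, v) then
      straighten_fuel d' (u ++ j :: i :: v)
      + contract (straighten_fuel d') u i j v
    else h0 w
  else 0.

Definition straighten w := straighten_fuel (measure w).+1 w.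

Lemma straighten_fuel_eq d d' w : (measure w < d)%N -> (measure w < d')%N ->
  straighten_fuel d w = straighten_fuel d' w.
Proof.
elim: d d' w => [|d IH] [|d'] w //= lt_d lt_d'.
case E: (first_descent w) => [[[[u i] j] v]|] //.
have [Ew lt_ji] := first_descentS E; rewrite Ew !ltnS in lt_d lt_d'.
have lt1 := measure_swap u v lt_ji.
have lt2 k := measure_contract u i j k v.
congr (_ + _); first by apply: IH; [apply: leq_trans lt_d|apply: leq_trans lt_d'].
apply: eq_bigr => k _; congr (C _ _ _ _).
by apply: IH; [apply: leq_trans lt_d|apply: leq_trans lt_d'].
Qed.

Lemma straightenE w : straighten w =
  if first_descent w is Some (u, i, j, v) then
    straighten (u ++ j :: i :: v) + contract straighten u i j v
  else h0 w.
Proof.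
rewrite {1}/straighten /=.
case E: (first_descent w) => [[[[u i] j] v]|] //.
have [-> lt_ji] := first_descentS E.
congr (_ + _); first by apply: straighten_fuel_eq; rewrite ?measure_swap.
apply: eq_bigr => k _; congr (C _ _ _ _).
by apply: straighten_fuel_eq; rewrite ?measure_contract.
Qed.

Lemma straighten_nondecreasing w : nondecreasing w -> straighten w = h0 w.
Proof.
rewrite straightenE; case E: (first_descent w) => [[[[u i] j] v]|] //.
have [-> lt_ji] := first_descentS E; rewrite /nondecreasing => H.
have: subseq [:: i; j] (u ++ i :: j :: v).
  by apply: subseq_trans (suffix_subseq _ _); rewrite -[[:: i; j]]cats0 /= !eqxx sub0seq.
have tr : transitive (fun i j : 'I_n => (i <= j)%N).
  by move=> a b c; apply: leq_trans.
by move/(subseq_sorted tr)/(_ H) => /=; rewrite leqNgt lt_ji.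
Qed.

Let h := straighten.
(** Here the descent is arbitrary, whereas [straighten] reduces the first one: [rule] for all words
    is confluence. *)
Let rule w := forall u i j v, w = u ++ i :: j :: v -> (j < i)%N ->
  h (u ++ i :: j :: v) = h (u ++ j :: i :: v) + contract h u i j v.

(** An ascent is the rule read backwards for the word with both letters exchanged, which has the
    same length; equal letters are covered by alternation. *)
Let rule_any w u i j v :
  (forall w', size w' = size w -> rule w') -> w = u ++ i :: j :: v ->
  h (u ++ i :: j :: v) = h (u ++ j :: i :: v) + contract h u i j v.
Proof.
move=> R Ew; have sz : size w = size (u ++ j :: i :: v).
  by rewrite Ew !size_cat /=.
case: (ltngtP i j) => [lt_ij|lt_ji|/val_inj E].
- rewrite (R _ (esym sz) u j i v erefl lt_ij) -addrA -[LHS]addr0; congr (_ + _).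
  rewrite -big_split big1 // => k _ /=.
  by rewrite C_anti addNr.
- exact: (R w).
- by rewrite E /contract big1 ?addr0 // => k _.
Qed.

(* Bergman's diamond lemma: overlapping descents are resolved by the Jacobi
   identity, disjoint ones by the commutation of the operators C. *)
Lemma straighten_rule w : rule w.
Proof.
have [m] := ubnP (measure w); elim: m w => // m IH w le_wm u i j v Ew lt_ji.
have {}IH w' : (measure w' < measure w)%N -> rule w'.
  by move=> lt; apply: IH; apply: leq_trans lt le_wm.
have short u' a b v' : (size (u' ++ a :: b :: v') < size w)%N ->
    h (u' ++ a :: b :: v') = h (u' ++ b :: a :: v') + contract h u' a b v'.
  move=> lt; apply: (@rule_any (u' ++ a :: b :: v')) => // w' sz.
  by apply: IH; apply: measure_short; rewrite sz.
have [u0 [i0 [j0 [v0 [E H]]]]] := first_descentP u v lt_ji.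
have [_ lt0] := first_descentS E.
rewrite {1}/h straightenE E -/h.
case: H => [[-> -> -> ->]//|[Eu Ei Ev]|[u2 [Eu Ev]]].
(* Overlap i0 > i > j: both orders of rewriting end in j i i0, and the contracted terms are compared
   by the Jacobi identity. *)
- subst u v0 j0; rewrite !cat_rcons /= in Ew E *.
  have l1 := measure_swap u0 (j :: v) lt0.
  have l2 : (measure (u0 ++ i :: j :: i0 :: v) < measure (u0 ++ i :: i0 :: j :: v))%N.
    by have := @measure_swap (rcons u0 i) i0 j v (ltn_trans lt_ji lt0); rewrite !cat_rcons.
  have l3 : (measure (u0 ++ i0 :: j :: i :: v) < measure (u0 ++ i0 :: i :: j :: v))%N.
    by have := @measure_swap (rcons u0 i0) i j v lt_ji; rewrite !cat_rcons.
  have l4 := @measure_swap u0 i0 j (i :: v) (ltn_trans lt_ji lt0).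
  have R1 := IH (u0 ++ i :: i0 :: j :: v); rewrite Ew in R1.
  have := R1 l1 (rcons u0 i) i0 j v; rewrite !cat_rcons => ->//; last first.
    exact: ltn_trans lt_ji lt0.
  have R2 := IH (u0 ++ i :: j :: i0 :: v); rewrite Ew in R2.
  rewrite (R2 (ltn_trans l2 l1) u0 i j (i0 :: v)) //.
  have R3 := IH (u0 ++ i0 :: j :: i :: v); rewrite Ew in R3.
  rewrite (R3 l3 u0 i0 j (i :: v) erefl (ltn_trans lt_ji lt0)).
  have R4 := IH (u0 ++ j :: i0 :: i :: v); rewrite Ew in R4.
  have := R4 (ltn_trans l4 l3) (rcons u0 j) i0 i v; rewrite !cat_rcons => -> //.
  rewrite -!addrA; congr (_ + _).
  have sh a b : (size (u0 ++ a :: b :: v) < size w)%N.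
    by rewrite Ew !size_cat /=; lia.
  (* The contribution of the iterated bracket [[a, b], c]. *)
  pose S a b c := \sum_p \sum_k C a b k (C k c p (h (u0 ++ p :: v))).
  have E1 a b c : contract h u0 a b (c :: v) =
      contract h (rcons u0 c) a b v + S a b c.
    rewrite /S exchange_big -big_split; apply: eq_bigr => k _ /=.
    by rewrite short // cat_rcons raddfD raddf_sum.
  have J : S i0 j i = S i j i0 + S i0 i j.
    apply/eqP; rewrite -subr_eq0 -big_split -sumrB big1 // => p _ /=.
    rewrite -big_split -sumrB -[RHS](C_jacobi i0 i j p (h (u0 ++ p :: v))).
    apply: eq_bigr => k _ /=.
    rewrite (C_anti k i0) raddfN (C_anti k j) raddfN (C_anti k i) raddfN.
    rewrite (C_anti j i0) opprD !opprK.
    by rewrite [LHS]addrC [in RHS]addrAC.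
  rewrite !E1 J.
  set X := contract _ _ i0 j _; set Y := contract _ _ i0 i _.
  set Z := contract _ _ i j _; set A := S _ _ _; set B := S _ _ _.
  by rewrite [LHS](AC (2*(1*2)) (3*4*1*2*5)) [RHS](AC (1*((1*2)*1)) (2*1*5*3*4)).
(* Disjoint descents: either order of rewriting leaves the same double contraction S, because the
   operators commute. *)
- subst u v0; rewrite -!catA /= in Ew E *.
  have l1 := measure_swap u0 (u2 ++ i :: j :: v) lt0.
  have l2 : (measure (u0 ++ i0 :: j0 :: u2 ++ j :: i :: v) < measure w)%N.
    rewrite Ew; have := measure_swap (u0 ++ i0 :: j0 :: u2) v lt_ji.
    by rewrite -!catA.
  rewrite -Ew in l1.
  have sh a b c : (size (u0 ++ c :: u2 ++ a :: b :: v) < size w)%N.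
    by rewrite Ew !size_cat /= !size_cat /=; lia.
  have := IH _ l1 (u0 ++ j0 :: i0 :: u2) i j v.
  rewrite -!catA => -> //.
  rewrite (IH _ l2 u0 i0 j0 (u2 ++ j :: i :: v)) // -!addrA; congr (_ + _).
  pose S := \sum_k \sum_p C i0 j0 k (C i j p (h (u0 ++ k :: u2 ++ p :: v))).
  have -> : contract h u0 i0 j0 (u2 ++ i :: j :: v) =
      contract h u0 i0 j0 (u2 ++ j :: i :: v) + S.
    rewrite -big_split; apply: eq_bigr => k _ /=.
    have := short (u0 ++ k :: u2) i j v; rewrite -!catA => ->; last exact: sh.
    rewrite raddfD raddf_sum; congr (_ + _).
    by apply: eq_bigr => p _; rewrite -catA.
  have -> : contract h (u0 ++ i0 :: j0 :: u2) i j v =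
      contract h (u0 ++ j0 :: i0 :: u2) i j v + S.
    rewrite /S exchange_big -big_split; apply: eq_bigr => p _ /=.
    rewrite -!catA /= short; last by rewrite Ew !size_cat /= !size_cat /=; lia.
    rewrite raddfD raddf_sum; congr (_ + _).
    by apply: eq_bigr => k _; rewrite C_comm.
  by rewrite addrCA.
Qed.

(** Existence half of PBW: by [straighten_nondecreasing], arbitrary values on nondecreasing words
    extend to all words in accordance with the relations; [compatible_eq] is the uniqueness half. *)
Theorem straighten_compatible : compatible straighten.
Proof.
move=> u i j v; apply/eqP; rewrite subr_eq addrC; apply/eqP.
by apply: (rule_any _ erefl) => w _; apply: straighten_rule.
Qed.

End Compatible.
End Straightening.

(** * Formal power series *)

Definition linear_pack (K : fieldType) (A B : lmodType K) (f : A -> B)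
    (f_lin : linear f) : {linear A -> B} :=
  HB.pack f (GRing.isLinear.Build K A B *:%R f f_lin).

Section LinearFacts.
Variables (K : fieldType) (A B : lmodType K) (f : A -> B) (f_lin : linear f).

Lemma lin0 : f 0 = 0. Proof. exact: (linear0 (linear_pack f_lin)). Qed.
Lemma linN : {morph f : x / - x}. Proof. exact: (linearN (linear_pack f_lin)). Qed.
Lemma linD : {morph f : x y / x + y}. Proof. exact: (linearD (linear_pack f_lin)). Qed.
Lemma linB : {morph f : x y / x - y}. Proof. exact: (linearB (linear_pack f_lin)). Qed.
Lemma linZ c : {morph f : x / c *: x}.
Proof. by move=> x; have := f_lin c x 0; rewrite lin0 !addr0. Qed.
Lemma lin_sum I (r : seq I) (P : pred I) (F : I -> A) :
  f (\sum_(i <- r | P i) F i) = \sum_(i <- r | P i) f (F i).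
Proof. exact: (linear_sum (linear_pack f_lin)). Qed.

End LinearFacts.

Lemma addfE (T : Type) (M : zmodType) (f g : T -> M) x : (f + g) x = f x + g x.
Proof. by []. Qed.

Lemma scalefE (R : pzRingType) (T : Type) (M : lmodType R) c (f : T -> M) x :
  (c *: f) x = c *: f x.
Proof. by []. Qed.

Section ConstantAndShift.
Variables A : zmodType.

Definition const_series (x : A) : nat -> A := fun n => if n is 0 then x else 0.
Definition shift_series (a : nat -> A) : nat -> A :=
  fun n => if n is m.+1 then a m else 0.

Lemma series_decomp a : a = const_series (a 0%N) + shift_series (fun n => a n.+1).
Proof. by apply/funext => -[|n]; rewrite addfE /= ?addr0 ?add0r. Qed.

End ConstantAndShift.

(* K[[t]]-linearity of a map of series: no continuity is needed, since
   commutation with t forces F (t^n a) to start at order n. *)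
Definition tlinear (A B : zmodType) (F : (nat -> A) -> nat -> B) : Prop :=
  {morph F : a b / a + b} /\ forall a, F (shift_series a) = shift_series (F a).

Section TLinearTheory.
Variables A B D : zmodType.
Implicit Types (F G : (nat -> A) -> nat -> B).

(** Write a = a_0 + t a'. Commutation with t turns coefficient n + 1 at t a' into coefficient n at
    a', so induction on the order leaves only constants. *)
Lemma tlinear_eq F G : tlinear F -> tlinear G ->
  (forall x, F (const_series x) =1 G (const_series x)) -> forall a, F a = G a.
Proof.
move=> [FD Fs] [GD Gs] E a; apply/funext => n.
elim: n a => [|n IH] a; rewrite (series_decomp a) FD GD Fs Gs !addfE E /= ?IH //.
Qed.

Lemma tlinear_comp (H : (nat -> B) -> nat -> D) F :
  tlinear H -> tlinear F -> tlinear (H \o F).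
Proof. by move=> [HD Hs] [FD Fs]; split=> a *; rewrite /= ?FD ?Fs ?HD ?Hs. Qed.

Lemma tlinearD F G : tlinear F -> tlinear G -> tlinear (fun a => F a + G a).
Proof.
move=> [FD Fs] [GD Gs]; split=> [a b|a]; first by rewrite FD GD addrACA.
by rewrite Fs Gs; apply/funext => -[|n]; rewrite !addfE //= addr0.
Qed.

Lemma tlinear0 : tlinear (fun _ : nat -> A => 0 : nat -> B).
Proof. by split=> [a b|a]; [rewrite addr0|apply/funext => -[]]. Qed.

Lemma tlinear_sum I (r : seq I) (F : I -> (nat -> A) -> nat -> B) :
  (forall i, tlinear (F i)) -> tlinear (fun a => \sum_(i <- r) F i a).
Proof.
move=> HF; elim: r => [|i r IH].
  by under eq_fun do rewrite big_nil; exact: tlinear0.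
by under eq_fun do rewrite big_cons; exact: tlinearD.
Qed.

End TLinearTheory.

Lemma sum_ord_support (A : zmodType) n N (F : nat -> A) :
  (n < N)%N -> (forall k, (n < k)%N -> F k = 0) ->
  \sum_(k < N) F k = \sum_(k < n.+1) F k.
Proof.
move=> lt_nN F0; rewrite (big_ord_widen N F lt_nN) [RHS]big_mkcond /=.
by apply: eq_bigr => k _; rewrite ltnS; case: leqP => // /F0.
Qed.

Section SeriesOperations.
Variables (K : fieldType) (A : lmodType K).
Implicit Types (mu : nat -> A -> A -> A) (phi : nat -> A -> A) (a b : nat -> A).

Lemma series_appE phi a n : series_app phi a n = \sum_(i < n.+1) phi i (a (n - i)%N).
Proof.
apply: eq_bigr => i _; have lt : (n - i < n.+1)%N by rewrite ltnS leq_subr.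
rewrite (bigD1 (Ordinal lt)) /=; last by rewrite subnKC // -ltnS.
rewrite big1 ?addr0 // => j /andP[/eqP E /eqP[]].
by apply/val_inj; rewrite /= -{2}E addKn.
Qed.

Lemma series_app_const phi x : (forall r, linear (phi r)) ->
  series_app phi (const_series x) =1 (fun n => phi n x).
Proof.
move=> phi_lin n; rewrite series_appE big_ord_recr /= subnn big1 ?add0r // => i _.
by rewrite -(subnSK (ltn_ord i)) /= (lin0 (phi_lin _)).
Qed.

Lemma series_app_tlinear phi : (forall r, linear (phi r)) -> tlinear (series_app phi).
Proof.
move=> phi_lin; split=> [a b|a]; apply/funext => n.
  rewrite addfE !series_appE -big_split; apply: eq_bigr => i _ /=.
  by rewrite !addfE (linD (phi_lin _)).
rewrite series_appE; case: n => [|n]; first by rewrite big_ord1 /= (lin0 (phi_lin _)).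
rewrite big_ord_recr /= subnn /= (lin0 (phi_lin _)) addr0 series_appE.
by apply: eq_bigr => i _; rewrite subSn // -ltnS.
Qed.

Let conv n (f : nat -> nat -> nat -> A) :=
  \sum_(i < n.+1) \sum_(j < n.+1) \sum_(k < n.+1 | (i + j + k == n)%N) f i j k.

Let conv_widen n N1 N2 N3 (f : nat -> nat -> nat -> A) : (n < N1)%N -> (n < N2)%N -> (n < N3)%N ->
  \sum_(i < N1) \sum_(j < N2) \sum_(k < N3 | (i + j + k == n)%N) f i j k = conv n f.
Proof.
move=> l1 l2 l3; pose g i j k := if (i + j + k == n)%N then f i j k else 0.
have g0 i j k : (n < i + j + k)%N -> g i j k = 0.
  by rewrite /g; case: eqP => // ->; rewrite ltnn.
transitivity (\sum_(i < n.+1) \sum_(j < n.+1) \sum_(k < n.+1) g i j k); last first.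
  by rewrite /conv; do 2!(apply: eq_bigr => ? _); rewrite [RHS]big_mkcond.
transitivity (\sum_(i < N1) \sum_(j < N2) \sum_(k < N3) g i j k).
  by do 2!(apply: eq_bigr => ? _); rewrite big_mkcond.
rewrite (sum_ord_support (F := fun i => \sum_(j < N2) \sum_(k < N3) g i j k) l1).
  apply: eq_bigr => i _.
  rewrite (sum_ord_support (F := fun j => \sum_(k < N3) g i j k) l2).
    apply: eq_bigr => j _; apply: sum_ord_support => // k lt.
    by rewrite g0 //; lia.
  by move=> j lt; rewrite big1 // => k _; rewrite g0 //; lia.
by move=> i lt; do 2!(rewrite big1 // => ? _); rewrite g0 //; lia.
Qed.

Let conv_shift n (f : nat -> nat -> nat -> A) : (forall i k, f i 0%N k = 0) ->
  conv n.+1 f = conv n (fun i j k => f i j.+1 k).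
Proof.
move=> f0; rewrite -(@conv_widen n n.+2 n.+1 n.+2) // /conv.
apply: eq_bigr => i _; rewrite big_ord_recl /= big1 ?add0r => [|k _]; last exact: f0.
by apply: eq_bigr => j _; apply: eq_bigl => k; rewrite /bump /= addnS.
Qed.

Lemma series_mul_flip mu a b :
  series_mul mu a b = series_mul (fun r x y => mu r y x) b a.
Proof.
apply/funext => n; apply: eq_bigr => i _; rewrite (exchange_big_dep predT) //=.
by apply: eq_bigr => k _; apply: eq_bigl => j; rewrite addnAC.
Qed.

Section Bilinear.
Variables (mu : nat -> A -> A -> A) (mu_bil : forall r, bilinear_map (mu r)).

Lemma series_mul_tlinearl b : tlinear (fun a => series_mul mu a b).
Proof.
have lin r y : linear (mu r ^~ y) by have [_] := mu_bil r; apply.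
split=> [a a'|a]; apply/funext => n.
  rewrite addfE -big_split; apply: eq_bigr => i _ /=.
  rewrite -big_split; apply: eq_bigr => j _ /=; rewrite -big_split.
  by apply: eq_bigr => k _; rewrite !addfE (linD (lin i _)).
case: n => [|n].
  rewrite /series_mul; apply: big1 => i _; apply: big1 => j _; apply: big1 => k _.
  by rewrite (ord1 j) /= (lin0 (lin _ _)).
exact: (@conv_shift n (fun i j k => mu i (shift_series a j) (b k))
                    (fun i k => lin0 (lin i (b k)))).
Qed.
End Bilinear.

Section BilinearSeries.
Variables (mu : nat -> A -> A -> A) (mu_bil : forall r, bilinear_map (mu r)).

Lemma series_mul_tlinearr a : tlinear (series_mul mu a).
Proof.
have -> : series_mul mu a = fun b => series_mul (fun r x y => mu r y x) b a.
  by apply/funext => b; rewrite series_mul_flip.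
by apply: series_mul_tlinearl => r; have [] := mu_bil r.
Qed.

Lemma series_mul_const x y :
  series_mul mu (const_series x) (const_series y) =1 (fun n => mu n x y).
Proof.
have linl r z : linear (mu r ^~ z) by have [_] := mu_bil r; apply.
have linr r z : linear (mu r z) by have [+ _] := mu_bil r; apply.
move=> n; rewrite /series_mul big_ord_recr /= big1 ?add0r => [|i _].
  rewrite big_ord_recl [X in _ + X]big1 ?addr0 => [|j _]; last first.
    by rewrite big1 // => k _; rewrite /= (lin0 (linl _ _)).
  rewrite (bigD1 ord0) /= ?addn0 // big1 ?addr0 // => k /andP[_ k0].
  by case: k k0 => -[|k] //= lt _; rewrite (lin0 (linr _ _)).
rewrite big1 // => j _; rewrite big1 // => k /eqP E.
case: j E => -[|j] /= _; last by rewrite (lin0 (linl _ _)).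
case: k => -[|k] /= _ E; last by rewrite (lin0 (linr _ _)).
by have := ltn_ord i; rewrite -{2}E; lia.
Qed.

Lemma series_mul_constl x b :
  series_mul mu (const_series x) b = series_app (fun r => mu r x) b.
Proof.
have linr r z : linear (mu r z) by have [+ _] := mu_bil r; apply.
apply: tlinear_eq => [||y n]; first exact: series_mul_tlinearr.
  by apply: series_app_tlinear.
by rewrite series_mul_const series_app_const.
Qed.

Lemma series_mul_constr y a :
  series_mul mu a (const_series y) = series_app (fun r => mu r ^~ y) a.
Proof.
have linr r z : linear (mu r ^~ z) by have [_ +] := mu_bil r; apply.
apply: (tlinear_eq (F := fun a => series_mul mu a _)) => [||x n].
- exact: series_mul_tlinearl.
- by apply: series_app_tlinear.
by rewrite series_mul_const series_app_const.
Qed.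

End BilinearSeries.

Section Inverse.
Variables (phi : nat -> A -> A).
Hypothesis phi0 : phi 0%N =1 id.
Hypothesis phi_lin : forall r, linear (phi r).

Lemma series_app_recl a n : series_app phi a n =
  a n + \sum_(i < n) phi i.+1 (a (n - i.+1)%N).
Proof. by rewrite series_appE big_ord_recl /= phi0 subn0. Qed.

(** As phi_0 is the identity, coefficient n of the image is a_n plus a function of earlier
    coefficients. The truncated form compares series known only to a finite order. *)
Lemma series_app_inj_upto m a b :
  (forall n, (n < m)%N -> series_app phi a n = series_app phi b n) ->
  forall n, (n < m)%N -> a n = b n.
Proof.
move=> E; elim/ltn_ind => n IH lt_nm; have := E n lt_nm.
rewrite !series_app_recl => En; move: En.
rewrite [X in _ + X = _](eq_bigr (fun i : 'I_n => phi i.+1 (b (n - i.+1)%N))).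
  by move/addIr.
by move=> i _; rewrite IH //; have := ltn_ord i; lia.
Qed.

Lemma series_app_inj a b : series_app phi a = series_app phi b -> a = b.
Proof.
move=> E; apply/funext => n; apply: (@series_app_inj_upto n.+1) => // k _.
by rewrite E.
Qed.

(** Fixed-point iteration for b = a - (t phi_1 + t^2 phi_2 + ...) b; m rounds settle the first m
    coefficients. *)
Fixpoint series_inv_iter a m : nat -> A :=
  if m is m'.+1 then
    fun n => a n - \sum_(i < n) phi i.+1 (series_inv_iter a m' (n - i.+1)%N)
  else fun=> 0.

Definition series_inv a : nat -> A := fun n => series_inv_iter a n.+1 n.

Lemma series_inv_iter_stable a m m' n : (n < m)%N -> (n < m')%N ->
  series_inv_iter a m n = series_inv_iter a m' n.
Proof.
elim: m m' n => [|m IH] [|m'] n //= lt lt'; congr (_ - _).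
apply: eq_bigr => i _; congr (phi _ _); have := ltn_ord i => lt_i.
by apply: IH; lia.
Qed.

Lemma series_invK a : series_app phi (series_inv a) = a.
Proof.
apply/funext => n; rewrite series_app_recl {1}/series_inv /= -addrA.
rewrite [X in _ + X](_ : _ = 0) ?addr0 // addrC -sumrB big1 // => i _.
rewrite -(linB (phi_lin _)) [X in phi _ X](_ : _ = 0) ?(lin0 (phi_lin _)) //.
apply/eqP; rewrite subr_eq0; apply/eqP.
by apply: series_inv_iter_stable => //; have := ltn_ord i; lia.
Qed.

Lemma series_appK a : series_inv (series_app phi a) = a.
Proof. by apply: series_app_inj; rewrite series_invK. Qed.

Lemma series_inv_tlinear : tlinear series_inv.
Proof.
have [FD Fs] := series_app_tlinear phi_lin.
split=> [a b|a]; apply: series_app_inj; first by rewrite FD !series_invK.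
by rewrite Fs !series_invK.
Qed.

End Inverse.
End SeriesOperations.

(** * Modules over the enveloping algebra *)

Section LinearMaps.
Variables (K : fieldType) (V W : lmodType K).

Definition linear_pred : {pred (V -> W)} := fun f => `[< linear f >].

Lemma linear_submod_closed : submod_closed linear_pred.
Proof.
split=> [|c f f' /asboolP f_lin /asboolP f'_lin]; apply/asboolP => d x y.
  by rewrite scaler0 addr0.
rewrite !addfE !scalefE f_lin f'_lin !scalerDr addrACA !scalerA.
by rewrite [c * d]mulrC.
Qed.
HB.instance Definition _ :=
  GRing.isSubmodClosed.Build K (V -> W) linear_pred linear_submod_closed.

Record linmap := Linmap { linmap_val :> V -> W; _ : linmap_val \in linear_pred }.
HB.instance Definition _ := [isSub for linmap_val].
HB.instance Definition _ := [Choice of linmap by <:].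
HB.instance Definition _ := [SubChoice_isSubLmodule of linmap by <:].

Lemma linmap_linear (f : linmap) : linear f.
Proof. exact/asboolP/(valP f). Qed.

Lemma linmapP (f f' : linmap) : f =1 f' -> f = f'.
Proof. by move=> E; apply/val_inj/funext. Qed.

Definition mk_linmap f (f_lin : linear f) := Linmap (introT (asboolP _) f_lin).

End LinearMaps.

(* The summand K^o makes the endomorphism ring nonzero for every V, as an
   algType has to be. *)
Section Endomorphisms.
Variables (K : fieldType) (V : lmodType K).
Notation W := (V * K^o)%type.

Definition lendo := linmap W W.
HB.instance Definition _ := GRing.Lmodule.on lendo.

Fact lendo1_subproof : linear (fun x : W => x). Proof. by []. Qed.
Fact lendoM_subproof (f f' : lendo) : linear (fun x => f (f' x)).
Proof. by move=> c x y; rewrite (linmap_linear f') (linmap_linear f). Qed.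

Definition lendo1 : lendo := mk_linmap lendo1_subproof.
Definition lendo_mul (f f' : lendo) : lendo := mk_linmap (lendoM_subproof f f').

Fact lendo_mulA : associative lendo_mul.
Proof. by move=> f f1 f2; apply/linmapP. Qed.
Fact lendo_mul1l : left_id lendo1 lendo_mul.
Proof. by move=> f; apply/linmapP. Qed.
Fact lendo_mul1r : right_id lendo1 lendo_mul.
Proof. by move=> f; apply/linmapP. Qed.
Fact lendo_mulDl : left_distributive lendo_mul +%R.
Proof. by move=> f f1 f2; apply/linmapP. Qed.
Fact lendo_mulDr : right_distributive lendo_mul +%R.
Proof. by move=> f f1 f2; apply/linmapP => x /=; rewrite (linD (linmap_linear f)). Qed.
Fact lendo_one_neq0 : lendo1 != 0.
Proof.
apply/eqP => /(congr1 (fun f : lendo => (f (0, 1)).2)) /= /eqP.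
by rewrite oner_eq0.
Qed.

HB.instance Definition _ := GRing.Zmodule_isNzRing.Build lendo
  lendo_mulA lendo_mul1l lendo_mul1r lendo_mulDl lendo_mulDr lendo_one_neq0.

Fact lendo_scaleAl c (f f' : lendo) : c *: (f * f') = c *: f * f'.
Proof. exact/linmapP. Qed.

HB.instance Definition _ := GRing.Lmodule_isLalgebra.Build K lendo lendo_scaleAl.

Fact lendo_scaleAr c (f f' : lendo) : c *: (f * f') = f * (c *: f').
Proof. by apply/linmapP => x /=; rewrite (linZ (linmap_linear f)). Qed.

HB.instance Definition _ := GRing.Lalgebra_isAlgebra.Build K lendo lendo_scaleAr.

End Endomorphisms.

(** By uniqueness in the universal property, U is a retract of the constructed algebra, whose
    elements are classes of expressions in g. *)
Lemma enveloping_ind (K : fieldType) (g : lmodType K) (br : g -> g -> g)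
    (U : algType K) (iota : g -> U) (P : U -> Prop) :
  universal_enveloping br iota ->
  (forall c, P c%:A) -> (forall x, P (iota x)) ->
  (forall u v, P u -> P v -> P (u + v)) -> (forall u v, P u -> P v -> P (u * v)) ->
  forall u, P u.
Proof.
move=> [iota_lie HU] Pc Pi PD PM u; have [F0 [_ uniq]] := HU U iota iota_lie.
have [F [FE _]] := HU _ _ (EnvelopingConstruction.gen_lie_morphism br).
have [G [GE _]] := (EnvelopingConstruction.gen_universal br).2 _ _ iota_lie.
have E : G (F u) = u.
  rewrite -[RHS]/((idfun : {lrmorphism U -> U}) u) (uniq idfun) //.
  by rewrite -(uniq (G \o F)) // => x /=; rewrite FE GE.
rewrite -E -[F u]EnvelopingConstruction.repK EnvelopingConstruction.cls_eval.
elim: (EnvelopingConstruction.rep _) => //= [x|s1 IH1 s2 IH2|s1 IH1 s2 IH2].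
- by rewrite GE.
- exact: PD.
- exact: PM.
Qed.

Section Modules.
Variables (K : fieldType) (g : lmodType K) (br : g -> g -> g).
Variables (U : algType K) (iota : g -> U) (HU : universal_enveloping br iota).
Variables (V : lmodType K) (rho : g -> V -> V).
Hypothesis rho_linl : forall v, linear (rho ^~ v).
Hypothesis rho_linr : forall x, linear (rho x).
Hypothesis rho_br : forall x y v,
  rho (br x y) v = rho x (rho y v) - rho y (rho x v).

(** A module is a morphism to an endomorphism algebra. The linear maps out of U needed for PBW and
    for the Adams operation arise by acting on a suitable vector. *)
Lemma module_extension : exists act : U -> V -> V,
  [/\ forall v, linear (act ^~ v), forall u, linear (act u),
      forall v, act 1 v = v,
      forall u u' v, act (u * u') v = act u (act u' v) &
      forall x v, act (iota x) v = rho x v].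
Proof.
have rho_lin x : linear (fun w : V * K^o => (rho x w.1, 0) : V * K^o).
  by move=> c [v a] [v' a'] /=; rewrite rho_linr; congr pair; rewrite /= scaler0 addr0.
pose r x : lendo V := mk_linmap (rho_lin x).
have r_lie : lie_morphism br r.
  split=> [c x y|x y]; apply/linmapP => -[v a]; congr pair => /=.
  - exact: rho_linl.
  - by rewrite scaler0 addr0.
  - exact: rho_br.
  - by rewrite subr0.
have [F [FE _]] := HU.2 _ _ r_lie.
(* V x 0 is stable under all of U, so the auxiliary line can be discarded. *)
have F2 u v : (F u (v, 0)).2 = 0.
  apply: (enveloping_ind (P := fun u => forall v, (F u (v, 0)).2 = 0) HU) => {u v}.
  - by move=> c v; rewrite linearZ rmorph1 /= scaler0.
  - by move=> x v; rewrite FE.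
  - by move=> u u' Hu Hu' v; rewrite rmorphD /= Hu Hu' addr0.
  - move=> u u' Hu Hu' v; rewrite rmorphM /=.
    by rewrite [F u' _]surjective_pairing Hu' Hu.
exists (fun u v => (F u (v, 0)).1); split.
- by move=> v c u u'; rewrite linearP.
- move=> u c v v'; have := linmap_linear (F u) c (v, 0) (v', 0).
  have -> : c *: (v, 0) + (v', 0) = (c *: v + v', 0) :> V * K^o.
    by congr pair; rewrite /= scaler0 addr0.
  by move=> ->.
- by move=> v; rewrite rmorph1.
- move=> u u' v; rewrite rmorphM /=; congr (F u _).1.
  by rewrite [LHS]surjective_pairing F2.
- by move=> x v; rewrite FE.
Qed.

End Modules.

(** * The Poincare-Birkhoff-Witt theorem *)

Section Coordinates.
Variables (K : fieldType) (g : vectType K).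
Notation n := (\dim {:g}).
Implicit Types (i j k : 'I_n).

Definition basis_vec i : g := (vbasis {:g})`_i.
Definition coordinate i (x : g) : K := coord (vbasis {:g}) i x.

Lemma coordinate_sum x : x = \sum_i coordinate i x *: basis_vec i.
Proof. exact: coord_vbasis (memvf x). Qed.

Lemma coordinate_basis i j : coordinate i (basis_vec j) = (j == i)%:R.
Proof. exact: coord_free (basis_free (vbasisP _)). Qed.

Lemma coordinate_lin i c x y :
  coordinate i (c *: x + y) = c * coordinate i x + coordinate i y.
Proof. by rewrite /coordinate linearP. Qed.

Lemma coordinateD i : {morph coordinate i : x y / x + y}.
Proof. by move=> x y; rewrite /coordinate linearD. Qed.

Lemma coordinateN i : {morph coordinate i : x / - x}.
Proof. by move=> x; rewrite /coordinate linearN. Qed.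

Lemma coordinate0 i : coordinate i 0 = 0.
Proof. by rewrite /coordinate linear0. Qed.

Lemma coordinate_bigsum i I (r : seq I) (F : I -> g) :
  coordinate i (\sum_(a <- r) F a) = \sum_(a <- r) coordinate i (F a).
Proof. by rewrite /coordinate linear_sum. Qed.

Lemma sum_coordinate_basis (M : lmodType K) (F : 'I_n -> M) i :
  \sum_k coordinate k (basis_vec i) *: F k = F i.
Proof.
rewrite (bigD1 i) //= coordinate_basis eqxx scale1r big1 ?addr0 // => k ne.
by rewrite coordinate_basis eq_sym (negPf ne) scale0r.
Qed.

Lemma linear_basis_eq (M : lmodType K) (f f' : g -> M) : linear f -> linear f' ->
  (forall i, f (basis_vec i) = f' (basis_vec i)) -> f =1 f'.
Proof.
move=> f_lin f'_lin E x; rewrite [x]coordinate_sum (lin_sum f_lin) (lin_sum f'_lin).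
by apply: eq_bigr => i _; rewrite (linZ f_lin) (linZ f'_lin) E.
Qed.

Definition structure_constant (m : g -> g -> g) i j k :=
  coordinate k (m (basis_vec i) (basis_vec j)).

Section Bilinear.
Variables (m : g -> g -> g) (m_bil : bilinear_map m).

Lemma coordinate_bracketr i y p : coordinate p (m (basis_vec i) y) =
  \sum_k coordinate k y * structure_constant m i k p.
Proof.
have lin := m_bil.1 (basis_vec i).
rewrite {1}[y]coordinate_sum (lin_sum lin) coordinate_bigsum.
by apply: eq_bigr => k _; rewrite (linZ lin) -[_ *: _]addr0 coordinate_lin coordinate0 addr0.
Qed.

Lemma coordinate_bracket x y p : coordinate p (m x y) =
  \sum_i \sum_j coordinate i x * coordinate j y * structure_constant m i j p.
Proof.
have lin := m_bil.2 y.
rewrite {1}[x]coordinate_sum (lin_sum lin) coordinate_bigsum.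
apply: eq_bigr => i _; rewrite (linZ lin) -[_ *: _]addr0 coordinate_lin coordinate0.
rewrite addr0 coordinate_bracketr mulr_sumr.
by apply: eq_bigr => j _; rewrite mulrA.
Qed.

End Bilinear.
End Coordinates.

Section Enveloping.
Variables (K : fieldType) (g : vectType K) (br : g -> g -> g).
Hypothesis Hbr : lie_bracket br.
Variables (U : algType K) (iota : g -> U) (HU : universal_enveloping br iota).
Notation n := (\dim {:g}).
Notation e := (@basis_vec K g).
Implicit Types (i j k : 'I_n) (u v w : seq 'I_n).

Let br_bil : bilinear_map br. Proof. by case: Hbr. Qed.
Let iota_lin : linear iota. Proof. by case: HU => -[]. Qed.

Lemma bracket_anti (m : g -> g -> g) : bilinear_map m -> alternating m ->
  forall x y, m x y = - m y x.
Proof.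
move=> [lr ll] alt x y; apply/eqP; rewrite -addr_eq0.
have := alt (x + y); rewrite (linD (lr _)) !(linD (ll _)) !alt add0r addr0.
by rewrite addrC => ->.
Qed.

Definition word_prod w : U := \prod_(i <- w) iota (e i).

Lemma word_prod_nil : word_prod [::] = 1.
Proof. exact: big_nil. Qed.

Lemma word_prod_cons i w : word_prod (i :: w) = iota (e i) * word_prod w.
Proof. exact: big_cons. Qed.

Lemma word_prod_cat w w' : word_prod (w ++ w') = word_prod w * word_prod w'.
Proof. exact: big_cat. Qed.

Lemma word_prod1 i : word_prod [:: i] = iota (e i).
Proof. exact: big_seq1. Qed.

Definition scale_constant (M : lmodType K) i j k : {additive M -> M} :=
  GRing.scale (structure_constant br i j k).

Lemma word_prod_compatible : compatible (@scale_constant U) word_prod.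
Proof.
move=> u i j v; rewrite /contract !word_prod_cat -mulrBr !word_prod_cons !mulrA -mulrBl.
rewrite -HU.1.2 [br _ _]coordinate_sum (lin_sum iota_lin) mulr_suml mulr_sumr.
apply: eq_bigr => k _; rewrite (linZ iota_lin) -scalerAl -scalerAr /=.
by rewrite word_prod_cat word_prod_cons.
Qed.

Section PBW.
Variable M : lmodType K.

Lemma straighten_scale_compatible h0 :
  compatible (@scale_constant M) (straighten (@scale_constant M) h0).
Proof.
have [_ alt jac] := Hbr.
apply: straighten_compatible.
- by move=> i k x /=; rewrite /structure_constant alt coordinate0 scale0r.
- by move=> i j k x /=; rewrite /structure_constant bracket_anti // coordinateN scaleNr.
- by move=> i j k i' j' k' x /=; rewrite !scalerA mulrC.
- move=> i j l p x /=.
  under eq_bigr do rewrite !scalerA -!scalerDl.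
  rewrite -scaler_suml 2!big_split /=.
  rewrite -!(coordinate_bracketr br_bil) -!coordinateD jac.
  by rewrite coordinate0 scale0r.
Qed.

Definition compat_pred : {pred (seq 'I_n -> M)} :=
  fun f => `[< compatible (@scale_constant M) f >].

Lemma compat_submod : submod_closed compat_pred.
Proof.
split=> [|c f f' /asboolP Hf /asboolP Hf']; apply/asboolP => u i j v.
  by rewrite /contract big1 => [|k _]; rewrite ?subr0 //= scaler0.
rewrite /contract !addfE !scalefE opprD addrACA -scalerBr Hf Hf' scaler_sumr -big_split.
by apply: eq_bigr => k _ /=; rewrite ?addfE ?scalefE scalerDr !scalerA mulrC.
Qed.
HB.instance Definition _ :=
  GRing.isSubmodClosed.Build K (seq 'I_n -> M) compat_pred compat_submod.

Record compat_fun := CompatFun {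
  compat_val :> seq 'I_n -> M; _ : compat_val \in compat_pred }.
HB.instance Definition _ := [isSub for compat_val].
HB.instance Definition _ := [Choice of compat_fun by <:].
HB.instance Definition _ := [SubChoice_isSubLmodule of compat_fun by <:].

(** Compatible functions play the role of linear maps from U to M; appending a letter is right
    multiplication of the argument, which leaves the relations intact. *)
Lemma compat_rcons (f : compat_fun) x :
  (fun w => \sum_i coordinate i x *: f (rcons w i)) \in compat_pred.
Proof.
have /asboolP Hf := valP f; apply/asboolP => u i j v.
rewrite -sumrB /contract.
under [RHS]eq_bigr do rewrite raddf_sum.
rewrite exchange_big; apply: eq_bigr => p _ /=.
rewrite -scalerBr !rcons_cat !rcons_cons Hf scaler_sumr.
by apply: eq_bigr => k _; rewrite /= !scalerA mulrC rcons_cat.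
Qed.

Definition compat_act x (f : compat_fun) := CompatFun (compat_rcons f x).

(** Since a word acts by appending its letters, evaluating its action on h at the empty word returns
    h of that word. *)
Lemma enveloping_extension h : compatible (@scale_constant M) h ->
  exists H : U -> M, linear H /\ forall w, H (word_prod w) = h w.
Proof.
move=> hc; have hP : h \in compat_pred by apply/asboolP.
have [f c x y||x y f|act [linl linr act1 actM actE]] :=
    @module_extension K g br U iota HU compat_fun compat_act.
- apply/val_inj/funext => w /=; rewrite ?addfE ?scalefE scaler_sumr -big_split.
  by apply: eq_bigr => i _ /=; rewrite coordinate_lin scalerDl scalerA.
- move=> x c f f'; apply/val_inj/funext => w /=; rewrite ?addfE ?scalefE scaler_sumr -big_split.
  by apply: eq_bigr => i _ /=; rewrite ?addfE ?scalefE scalerDr !scalerA mulrC.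
- have /asboolP Hf := valP f.
  apply/val_inj/funext => w /=; rewrite ?addfE.
  under [X in _ = X - _]eq_bigr do rewrite scaler_sumr.
  under [X in _ = _ - X]eq_bigr do rewrite scaler_sumr.
  rewrite [X in _ = _ - X]exchange_big -sumrB /=.
  under eq_bigr do rewrite (coordinate_bracket br_bil) scaler_suml.
  rewrite exchange_big; apply: eq_bigr => i _ /=.
  under eq_bigr do rewrite scaler_suml.
  rewrite exchange_big -sumrB; apply: eq_bigr => j _ /=.
  rewrite !scalerA [in X in _ = _ - X]mulrC -scalerBr -!cats1 -!catA /= Hf scaler_sumr.
  by apply: eq_bigr => k _; rewrite /= scalerA cats1.
exists (fun x => compat_val (act x (CompatFun hP)) [::]); split.
  by move=> c u u'; rewrite linl.
suff E w w' : compat_val (act (word_prod w) (CompatFun hP)) w' = h (w' ++ w).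
  by move=> w; rewrite E.
elim: w w' => [|i w IH] w'; first by rewrite word_prod_nil act1 cats0.
rewrite word_prod_cons actM actE /= sum_coordinate_basis.
by rewrite IH cat_rcons.
Qed.

(** Linear independence of nondecreasing words as an extension property. Taking for M a space of
    functions later gives maps of two variables. *)
Lemma pbw_extension (h0 : seq 'I_n -> M) :
  exists H : U -> M, linear H /\
    forall w, nondecreasing w -> H (word_prod w) = h0 w.
Proof.
have [H [H_lin HE]] := enveloping_extension (straighten_scale_compatible h0).
by exists H; split=> // w ws; rewrite HE straighten_nondecreasing.
Qed.

End PBW.

Lemma iota_injective : injective iota.
Proof.
have [H [H_lin HE]] := pbw_extension (fun w => if w is [:: i] then e i else 0).
have Hi : H \o iota =1 id.
  apply: linear_basis_eq => // [c x y|i] /=.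
    by rewrite iota_lin H_lin.
  by rewrite -word_prod1 HE.
by move=> x y E; rewrite -[x]Hi /= E; apply: Hi.
Qed.

(** * The filtration of U by word length *)

Definition subspace (Q : U -> Prop) :=
  Q 0 /\ forall c x y, Q x -> Q y -> Q (c *: x + y).

Lemma subspaceD Q : subspace Q -> forall x y, Q x -> Q y -> Q (x + y).
Proof. by move=> [_ H] x y Qx Qy; rewrite -[x]scale1r; apply: H. Qed.

Lemma subspaceZ Q : subspace Q -> forall c x, Q x -> Q (c *: x).
Proof. by move=> [Q0 H] c x Qx; rewrite -[_ *: _]addr0; apply: H. Qed.

Lemma subspaceB Q : subspace Q -> forall x y, Q x -> Q y -> Q (x - y).
Proof.
by move=> HQ x y Qx Qy; rewrite -scaleN1r; apply: subspaceD => //; apply: subspaceZ.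
Qed.

Lemma subspace_sum Q : subspace Q -> forall I (r : seq I) (F : I -> U),
  (forall a, Q (F a)) -> Q (\sum_(a <- r) F a).
Proof.
by move=> HQ I r F QF; apply: big_ind => // [|x y]; [case: HQ|apply: subspaceD].
Qed.

(** The span of the words of length at most d, as an intersection of subspaces, so that membership
    is itself an induction principle. *)
Definition filtration d (x : U) := forall Q, subspace Q ->
  (forall w, (size w <= d)%N -> Q (word_prod w)) -> Q x.

Lemma filtration_subspace d : subspace (filtration d).
Proof.
split=> [Q [] //|c x y Hx Hy Q HQ Qw].
by case: (HQ) => _; apply; [apply: Hx|apply: Hy].
Qed.

Lemma filtration_le d d' x : (d <= d')%N -> filtration d x -> filtration d' x.
Proof.
by move=> le Hx Q HQ Qw; apply: Hx => // w lw; apply: Qw; apply: leq_trans le.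
Qed.

Lemma filtration_word w : filtration (size w) (word_prod w).
Proof. by move=> Q _; apply. Qed.

Lemma filtration1 : filtration 0 1.
Proof. by have := @filtration_word [::]; rewrite word_prod_nil. Qed.

Lemma filtrationM d d' x y : filtration d x -> filtration d' y ->
  filtration (d + d') (x * y).
Proof.
move=> Hx Hy Q HQ Qw; apply: (Hx (fun x => Q (x * y))) => [|w lw].
  split=> [|c a b Qa Qb]; first by rewrite mul0r; case: HQ.
  by rewrite mulrDl -scalerAl; case: HQ => _; apply.
apply: (Hy (fun y => Q (word_prod w * y))) => [|w' lw'].
  split=> [|c a b Qa Qb]; first by rewrite mulr0; case: HQ.
  by rewrite mulrDr -scalerAr; case: HQ => _; apply.
by rewrite -word_prod_cat; apply: Qw; rewrite size_cat leq_add.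
Qed.

Lemma filtration_iota x : filtration 1 (iota x).
Proof.
rewrite [x]coordinate_sum (lin_sum iota_lin).
apply: (subspace_sum (filtration_subspace 1)) => i; rewrite (linZ iota_lin).
apply: (subspaceZ (filtration_subspace 1)); rewrite -word_prod1; exact: (@filtration_word [:: i]).
Qed.

Lemma filtration_exhaust x : exists d, filtration d x.
Proof.
apply: (enveloping_ind (P := fun x => exists d, filtration d x) HU) => {x} [c|x|x y [d Hx] [d' Hy]|x y [d Hx] [d' Hy]].
- by exists 0%N; apply: (subspaceZ (filtration_subspace 0)); apply: filtration1.
- by exists 1%N; apply: filtration_iota.
- exists (d + d')%N; apply: (subspaceD (filtration_subspace _)).
    by apply: filtration_le Hx; apply: leq_addr.
  by apply: filtration_le Hy; apply: leq_addl.
- by exists (d + d')%N; apply: filtrationM.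
Qed.

Lemma nondecreasing_span Q : subspace Q ->
  (forall w, nondecreasing w -> Q (word_prod w)) -> forall x, Q x.
Proof.
move=> HQ Qs x; have [d Hx] := filtration_exhaust x; apply: Hx => // w _.
elim/straightening_ind: w => // u i j v _ Q1 Q2.
rewrite -[word_prod _](subrK (word_prod (u ++ j :: i :: v))) word_prod_compatible.
apply: subspaceD => //; apply: subspace_sum => // k /=.
exact: subspaceZ.
Qed.

Lemma linear_eq_nondecreasing (M : lmodType K) (f f' : U -> M) :
  linear f -> linear f' ->
  (forall w, nondecreasing w -> f (word_prod w) = f' (word_prod w)) -> f =1 f'.
Proof.
move=> f_lin f'_lin E; apply: nondecreasing_span => //.
split=> [|c x y Ex Ey]; first by rewrite (lin0 f_lin) (lin0 f'_lin).
by rewrite f_lin f'_lin Ex Ey.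
Qed.

End Enveloping.

(** * The equivariant retraction onto the Lie algebra *)

Section Retraction.
Variables (K : fieldType) (g : vectType K) (br : g -> g -> g).
Variables (U : algType K) (iota : g -> U) (HU : universal_enveloping br iota).
Hypothesis char0 : [pchar K] =i pred0.
Notation word_prod := (word_prod iota).
Notation filtration := (filtration iota).

Let iota_lin : linear iota. Proof. by case: HU => -[]. Qed.

(* In Sweedler notation Theta u c is the sum of the u' c u'', and Theta u 1 is
   the second Adams operation (the convolution square of the identity); the
   tensor square of U is avoided by letting g act on the maps U -> U. *)
Lemma adams_operation : exists Theta : U -> U -> U,
  [/\ forall c, linear (Theta ^~ c), forall c, Theta 1 c = c,
      forall x u c, Theta (iota x * u) c = iota x * Theta u c + Theta u (c * iota x) &
      forall y u, Theta (iota y * u - u * iota y) 1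
                  = iota y * Theta u 1 - Theta u 1 * iota y].
Proof.
have rho_lin x (F : linmap U U) : linear (fun c => iota x * F c + F (c * iota x)).
  move=> a c d; rewrite (linmap_linear F) mulrDr mulrDl -scalerAl (linmap_linear F).
  by rewrite scalerDr addrACA scalerAr.
(* Following its coproduct, x goes to the left of the value or to the right of the argument; on the
   identity map this builds the sum of the u' c u''. *)
pose rho x F : linmap U U := mk_linmap (rho_lin x F).
have preL_lin y (F : linmap U U) : linear (fun c => F (iota y * c)).
  by move=> a c d; rewrite mulrDr -scalerAr (linmap_linear F).
have postR_lin y (F : linmap U U) : linear (fun c => F c * iota y).
  by move=> a c d; rewrite (linmap_linear F) mulrDl -scalerAl.
(* Both maps commute with [rho], hence with U, and on the identity map their sum is [rho y]. This
   carries a right factor y of u out of [Theta]. *)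
pose preL y F : linmap U U := mk_linmap (preL_lin y F).
pose postR y F : linmap U U := mk_linmap (postR_lin y F).
have [F c x y|x c F G|x y F|act [linl linr act1 actM actE]] :=
  @module_extension K g br U iota HU (linmap U U) rho.
- apply/linmapP => d /=; rewrite addfE scalefE /= iota_lin mulrDl mulrDr.
  by rewrite -scalerAl -scalerAr (linmap_linear F) scalerDr addrACA.
- apply/linmapP => d /=; rewrite !addfE !scalefE mulrDr scalerDr addrACA.
  by rewrite scalerAr.
- apply/linmapP => d /=; rewrite HU.1.2 mulrBl mulrBr (linB (linmap_linear F)) !mulrA.
  rewrite -[RHS]/((_ + _) - (_ + _)) !mulrDr !mulrA !opprD.
  by rewrite [RHS](AC ((2*2)*(2*2)) ((1*5)*(4*8)*(2*7)*(3*6))) /= !subrr !addr0.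
have actL y u F : act u (preL y F) = preL y (act u F).
  move: F; apply: (enveloping_ind
    (P := fun u => forall F, act u (preL y F) = preL y (act u F)) HU) => {u}.
  - by move=> c F; rewrite !(linZ (linl _)) !act1; apply/linmapP.
  - by move=> x F; rewrite !actE; apply/linmapP => c /=; rewrite mulrA.
  - by move=> u v Hu Hv F; rewrite !(linD (linl _)) Hu Hv; apply/linmapP.
  - by move=> u v Hu Hv F; rewrite !actM Hv Hu.
have actR y u F : act u (postR y F) = postR y (act u F).
  move: F; apply: (enveloping_ind
    (P := fun u => forall F, act u (postR y F) = postR y (act u F)) HU) => {u}.
  - move=> c F; rewrite !(linZ (linl _)) !act1; apply/linmapP => d /=.
    by rewrite !scalefE scalerAl.
  - by move=> x F; rewrite !actE; apply/linmapP => c /=; rewrite mulrDl mulrA.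
  - move=> u v Hu Hv F; rewrite !(linD (linl _)) Hu Hv; apply/linmapP => c /=.
    by rewrite !addfE mulrDl.
  - by move=> u v Hu Hv F; rewrite !actM Hv Hu.
have id_lin : linear (fun c : U => c) by [].
pose I : linmap U U := mk_linmap id_lin.
exists (fun u c => act u I c); split.
- by move=> c a u v; rewrite linl.
- by move=> c; rewrite act1.
- by move=> x u c; rewrite actM actE.
- move=> y u; rewrite (linB (linl _)) -[LHS]/(_ - _) !actM !actE.
  have -> : rho y I = preL y I + postR y I by apply/linmapP.
  rewrite (linD (linr _)) actL actR /= -[X in _ - X]/(_ + _) /= mul1r mulr1.
  by rewrite opprD addrA addrK.
Qed.

(** The commutator with y is a derivation sending a letter to an element of g, so it does not
    lengthen words. *)
Lemma filtration_ad d y x :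
  filtration d x -> filtration d (iota y * x - x * iota y).
Proof.
have sub := filtration_subspace iota d.
move=> Hx; apply: (Hx (fun x => filtration d (iota y * x - x * iota y))) => [|w].
  split=> [|c a b Ha Hb]; first by rewrite mulr0 mul0r subr0; case: sub.
  rewrite mulrDr mulrDl -scalerAr -scalerAl opprD addrACA -scalerBr.
  by case: sub => _; apply.
move=> le_wd; apply: (filtration_le le_wd) => {x Hx sub d le_wd}.
elim: w => [|i w IH].
  by rewrite word_prod_nil mulr1 mul1r subrr; case: (filtration_subspace iota 0).
rewrite word_prod_cons /=.
have -> : iota y * (iota (basis_vec i) * word_prod w)
          - iota (basis_vec i) * word_prod w * iota y =
    iota (br y (basis_vec i)) * word_prod w
    + iota (basis_vec i) * (iota y * word_prod w - word_prod w * iota y).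
  by rewrite HU.1.2 mulrBl mulrBr !mulrA [RHS]addrA subrK.
apply: (subspaceD (filtration_subspace _ _)); apply: (@filtrationM _ _ _ _ 1) => //;
  try exact: (filtration_iota HU).
exact: filtration_word.
Qed.

Lemma filtration_one x : filtration 1 x -> exists c y, x = c%:A + iota y.
Proof.
move=> Hx; apply: (Hx (fun x => exists c y, x = c%:A + iota y)).
  split=> [|c _ _ [c1 [y1 ->]] [c2 [y2 ->]]].
    by exists 0, 0; rewrite scale0r (lin0 iota_lin) addr0.
  exists (c * c1 + c2), (c *: y1 + y2).
  by rewrite iota_lin scalerDr scalerDl scalerA addrACA.
case=> [|i [|j w]] // _.
  by exists 1, 0; rewrite word_prod_nil scale1r (lin0 iota_lin) addr0.
by exists 0, (basis_vec i); rewrite word_prod1 scale0r add0r.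
Qed.

(** * Eigenvalues of the Adams operation *)

Section Adams.
Variable Theta : U -> U -> U.
Hypothesis Theta_lin : forall c, linear (Theta ^~ c).
Hypothesis Theta1 : forall c, Theta 1 c = c.
Hypothesis ThetaM : forall x u c,
  Theta (iota x * u) c = iota x * Theta u c + Theta u (c * iota x).
Hypothesis Theta_ad : forall y u, Theta (iota y * u - u * iota y) 1
  = iota y * Theta u 1 - Theta u 1 * iota y.

(** A letter x in front of W gives two terms, led by multiples of x W c and W c x, which agree up to
    a commutator of lower degree: hence one factor 2 per letter. The recursion changes c, which must
    therefore be arbitrary. *)
Lemma adams_leading w c m : filtration m c ->
  filtration (size w + m).-1
    (Theta (word_prod w) c - 2%:R ^+ size w *: (word_prod w * c)).
Proof.
elim: w c m => [|i w IH] c m Hc.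
  rewrite word_prod_nil Theta1 expr0 scale1r mul1r subrr.
  by case: (filtration_subspace iota (0 + m).-1).
rewrite word_prod_cons ThetaM /=; set x := iota _; set W := word_prod w.
pose q : K := 2%:R ^+ size w.
have -> : x * Theta W c + Theta W (c * x) - 2%:R ^+ (size w).+1 *: (x * W * c) =
    x * (Theta W c - q *: (W * c)) + (Theta W (c * x) - q *: (W * (c * x)))
    - q *: (x * (W * c) - (W * c) * x).
  rewrite exprS -/q -scalerA scaler_nat mulr2n !scalerBr mulrBr -scalerAr !mulrA.
  set a := x * _; set b := Theta _ _; set r := q *: _; set t := q *: _.
  rewrite !opprD opprK [RHS](AC ((2*2)*2) ((1*3*(2*5))*(4*6))).
  by rewrite /= addNr addr0.
have Hx := filtration_iota HU (basis_vec i).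
apply: (subspaceB (filtration_subspace _ _)); last first.
  apply: (subspaceZ (filtration_subspace _ _)); apply: filtration_ad.
  by apply: filtrationM => //; apply: filtration_word.
apply: (subspaceD (filtration_subspace _ _)); last first.
  have := IH (c * x) (m + 1)%N (filtrationM Hc Hx).
  by rewrite addnA addn1.
(* The empty word is separated because of the truncated predecessor: 1 + (size w + m).-1 is size w +
   m only when the latter is positive. *)
case: (w) @W @q IH => [|j w'] W q IH.
  rewrite /W /q word_prod_nil Theta1 expr0 scale1r mul1r subrr mulr0.
  by case: (filtration_subspace iota (0 + m)).
exact: (filtrationM Hx (IH c m Hc)).
Qed.

Let psi u := Theta u 1.
Let psi_lin : linear psi := Theta_lin 1.

Lemma adams_lower d x : filtration d.+2 x ->
  filtration d.+1 (psi x - 2%:R ^+ d.+2 *: x).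
Proof.
have sub := filtration_subspace iota d.+1.
move=> Hx; apply: (Hx (fun x => filtration d.+1 (psi x - 2%:R ^+ d.+2 *: x))).
  split=> [|c a b Ha Hb]; first by rewrite (lin0 psi_lin) scaler0 subr0; case: sub.
  rewrite psi_lin scalerDr opprD addrACA scalerA mulrC -scalerA -scalerBr.
  by case: sub => _; apply.
move=> w; have := @adams_leading w _ _ (@filtration1 _ _ _ iota); rewrite addn0 mulr1 -/(psi _).
rewrite leq_eqVlt => H /orP[/eqP E|lt]; first by rewrite E in H.
apply: (subspaceB sub); last first.
  apply: (subspaceZ sub).
  exact: (@filtration_le _ _ _ _ (size w) _ _ lt (@filtration_word _ _ _ _ w)).
rewrite -(subrK (2%:R ^+ size w *: word_prod w) (psi _)); apply: (subspaceD sub).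
  by apply: filtration_le H; lia.
apply: (subspaceZ sub); exact: (@filtration_le _ _ _ _ (size w) _ _ lt (@filtration_word _ _ _ _ w)).
Qed.

(** The operator (psi - 1)(psi - 4)...(psi - 2^(d+1)), with the factor for the eigenvalue 2 left
    out; [annihilator_eigenvalue] is its value at psi = 2. *)
Fixpoint adams_annihilator d (x : U) : U :=
  if d is d'.+1 then adams_annihilator d' (psi x - 2%:R ^+ d'.+2 *: x)
  else psi x - x.

Fixpoint annihilator_eigenvalue d : K :=
  if d is d'.+1 then (2%:R - 2%:R ^+ d'.+2) * annihilator_eigenvalue d' else 1.

Lemma adams_annihilator_linear d : linear (adams_annihilator d).
Proof.
elim: d => [|d IH] c x y /=; first by rewrite psi_lin opprD addrACA scalerBr.
by rewrite -IH psi_lin scalerDr opprD addrACA scalerA mulrC -scalerA -scalerBr.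
Qed.

Lemma adams_annihilator_ad d y x :
  adams_annihilator d (iota y * x - x * iota y) =
  iota y * adams_annihilator d x - adams_annihilator d x * iota y.
Proof.
elim: d x => [|d IH] x /=; rewrite /psi Theta_ad -/(psi _).
  by rewrite mulrBr mulrBl !opprD !opprK addrACA.
rewrite -IH; congr adams_annihilator.
rewrite mulrBr mulrBl !opprD !opprK addrACA scalerBr opprB -scalerAr -scalerAl.
by rewrite [- _ + _]addrC.
Qed.

Lemma psi_iota x : psi (iota x) = 2%:R *: iota x.
Proof.
by rewrite /psi -[iota x in LHS]mulr1 ThetaM !Theta1 mulr1 mul1r scaler_nat mulr2n.
Qed.

Lemma adams_annihilator_iota d x :
  adams_annihilator d (iota x) = annihilator_eigenvalue d *: iota x.
Proof.
elim: d => [|d IH] /=; first by rewrite psi_iota scaler_nat mulr2n addrK scale1r.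
by rewrite psi_iota -scalerBl (linZ (@adams_annihilator_linear d)) IH scalerA.
Qed.

Lemma annihilator_eigenvalue_neq0 d : annihilator_eigenvalue d != 0.
Proof.
elim: d => [|d IH] /=; first exact: oner_neq0.
rewrite mulf_neq0 // subr_eq0 eq_sym -subr_eq0 -natrX -natrB; last first.
  by rewrite -{1}(expn1 2) leq_exp2l.
by rewrite (pcharf0P K).1 // subn_eq0 -{2}(expn1 2) leq_exp2l.
Qed.

(** The factors psi - 2^k lower the degree one by one down to 1, where psi - 1 removes the
    constants. *)
Lemma adams_annihilator_range d x :
  filtration d.+1 x -> exists y, adams_annihilator d x = iota y.
Proof.
elim: d x => [|d IH] x Hx /=; last by apply: IH; apply: adams_lower.
have [c [y ->]] := filtration_one Hx; exists y.
rewrite (linD psi_lin) (linZ psi_lin) psi_iota {1}/psi Theta1 scaler_nat mulr2n.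
by rewrite addrA addrAC subrr add0r.
Qed.

End Adams.

Lemma equivariant_retraction d : exists p : U -> U,
  [/\ linear p,
      forall y u, p (iota y * u - u * iota y) = iota y * p u - p u * iota y,
      forall x, p (iota x) = iota x &
      forall u, filtration d u -> exists y, p u = iota y].
Proof.
have [Theta [lin T1 TM Tad]] := adams_operation.
pose s := annihilator_eigenvalue d; have s0 : s != 0 := annihilator_eigenvalue_neq0 d.
exists (fun u => s^-1 *: adams_annihilator Theta d u); split.
- move=> c u v; rewrite (adams_annihilator_linear lin) scalerDr !scalerA.
  by rewrite mulrC.
- by move=> y u; rewrite adams_annihilator_ad // scalerBr -scalerAr -scalerAl.
- by move=> x; rewrite adams_annihilator_iota // scalerA mulVf ?scale1r.
- move=> u /(filtration_le (leqnSn d)) /(adams_annihilator_range lin T1 TM)[y ->].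
  by exists (s^-1 *: y); rewrite (linZ iota_lin).
Qed.

End Retraction.

(** * The deformed enveloping algebra *)

Section SeriesCommutation.
Variables (K : fieldType) (A : lmodType K).
Implicit Types (phi : nat -> A -> A) (a b : nat -> A).

Lemma series_app_const2 phi phi' x n :
  (forall r, linear (phi r)) -> (forall r, linear (phi' r)) ->
  series_app phi (series_app phi' (const_series x)) n =
  \sum_(i < n.+1) phi i (phi' (n - i)%N x).
Proof.
move=> lin lin'; rewrite series_appE; apply: eq_bigr => i _.
by rewrite series_app_const.
Qed.

Lemma series_app_comm phi phi' a :
  (forall r, linear (phi r)) -> (forall r, linear (phi' r)) ->
  (forall i j x, phi i (phi' j x) = phi' j (phi i x)) ->
  series_app phi (series_app phi' a) = series_app phi' (series_app phi a).
Proof.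
move=> lin lin' comm.
have T := series_app_tlinear lin; have T' := series_app_tlinear lin'.
apply: (tlinear_eq (tlinear_comp T T') (tlinear_comp T' T)) => x n /=.
rewrite !series_app_const2 // (reindex_inj rev_ord_inj) /=.
apply: eq_bigr => i _; rewrite comm subSS subKn //.
by rewrite -ltnS.
Qed.

Definition series_scale (c : nat -> K) : (nat -> A) -> nat -> A :=
  series_app (fun r x => c r *: x).

Lemma scale_lin (c : nat -> K) r : linear (fun x : A => c r *: x).
Proof. by move=> d x y; rewrite scalerDr !scalerA mulrC. Qed.

Lemma series_scale_tlinear c : tlinear (series_scale c).
Proof. exact: series_app_tlinear (scale_lin c). Qed.

Lemma series_scale_sub c : {morph series_scale c : a b / a - b}.
Proof.
have [D _] := series_scale_tlinear c.
by move=> a b; apply/eqP; rewrite eq_sym subr_eq -D subrK.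
Qed.

Definition series_scale_additive c : {additive (nat -> A) -> (nat -> A)} :=
  HB.pack (series_scale c)
    (GRing.isZmodMorphism.Build _ _ (series_scale c) (series_scale_sub c)).

Lemma series_scaleN c a : series_scale (fun r => - c r) a = - series_scale c a.
Proof.
apply/funext => n; rewrite /series_scale -[RHS]/(- _) !series_appE -sumrN.
by apply: eq_bigr => i _; rewrite scaleNr.
Qed.

Lemma series_scale0 a : series_scale (fun=> 0) a = 0.
Proof.
by apply/funext => n; rewrite /series_scale series_appE big1 // => i _; rewrite scale0r.
Qed.

Lemma series_scaleC c d a :
  series_scale c (series_scale d a) = series_scale d (series_scale c a).
Proof.
apply: series_app_comm => [r|r|i j x]; try exact: scale_lin.
by rewrite !scalerA mulrC.
Qed.

Section Bilinear.
Variables (mu : nat -> A -> A -> A) (mu_bil : forall r, bilinear_map (mu r)).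

Lemma series_mul_scaler c a b :
  series_mul mu a (series_scale c b) = series_scale c (series_mul mu a b).
Proof.
have T := series_scale_tlinear c.
apply: (tlinear_eq (F := fun a => series_mul mu a (series_scale c b))
         (series_mul_tlinearl mu_bil _)
         (tlinear_comp T (series_mul_tlinearl mu_bil b))) => x n /=.
rewrite !series_mul_constl // [in LHS]/series_scale series_app_comm //.
- by move=> r; have [+ _] := mu_bil r; apply.
- exact: scale_lin.
- by move=> i j y; have [H _] := mu_bil i; rewrite (linZ (H x)).
Qed.

Lemma series_mul_linearr a : linear (series_mul mu a).
Proof.
move=> c b b'; apply/funext => n; rewrite addfE scalefE.
rewrite /series_mul scaler_sumr -big_split; apply: eq_bigr => i _ /=.
rewrite scaler_sumr -big_split; apply: eq_bigr => j _ /=.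
rewrite scaler_sumr -big_split; apply: eq_bigr => k _ /=.
by have [-> _] := mu_bil i.
Qed.
End Bilinear.

Section BilinearLeft.
Variables (mu : nat -> A -> A -> A) (mu_bil : forall r, bilinear_map (mu r)).

Let flip_bil r : bilinear_map (fun x y => mu r y x).
Proof. by have [] := mu_bil r. Qed.

Lemma series_mul_scalel c a b :
  series_mul mu (series_scale c a) b = series_scale c (series_mul mu a b).
Proof. by rewrite series_mul_flip series_mul_scaler // -series_mul_flip. Qed.

Lemma series_mul_linearl b : linear (fun a => series_mul mu a b).
Proof.
move=> c a a'; rewrite ![series_mul mu _ b]series_mul_flip.
exact: series_mul_linearr.
Qed.

End BilinearLeft.
End SeriesCommutation.

Lemma const_series_linear (K : fieldType) (A : lmodType K) :
  linear (@const_series A : A -> nat -> A).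
Proof. 
by move=> c x y; apply/funext => -[|n] //; rewrite addfE scalefE /= scaler0 addr0.
Qed.

Section DeformedProduct.
Variables (K : fieldType) (g : vectType K) (br : g -> g -> g).
Hypothesis Hbr : lie_bracket br.
Variables (U : algType K) (iota : g -> U) (HU : universal_enveloping br iota).
Variables (mu : nat -> g -> g -> g) (Hmu : lie_deformation br mu).
Notation n := (\dim {:g}).
Notation e := (@basis_vec K g).
Notation word_prod := (word_prod iota).
Implicit Types (i j k : 'I_n) (w : seq 'I_n).

Let iota_lin : linear iota. Proof. by case: HU => -[]. Qed.
Let mu_bil r : bilinear_map (mu r). Proof. by case: Hmu => _ /(_ r) []. Qed.
Let mu_alt r : alternating (mu r). Proof. by case: Hmu => _ /(_ r) []. Qed.

Definition series_constant i j k : nat -> K :=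
  fun r => structure_constant (mu r) i j k.

Definition scale_series_constant i j k : {additive (nat -> U) -> (nat -> U)} :=
  series_scale_additive U (series_constant i j k).

(** Normal form of a word under the relations of mu_t, each nondecreasing word being identified with
    its product in U. *)
Definition deformed_word : seq 'I_n -> nat -> U :=
  straighten scale_series_constant (fun w => const_series (word_prod w)).

Lemma series_jacobi i j l p s :
  \sum_(r < s.+1) \sum_m
    (series_constant j l m r * series_constant i m p (s - r)%N
     + series_constant l i m r * series_constant j m p (s - r)%N
     + series_constant i j m r * series_constant l m p (s - r)%N) = 0.
Proof.
have [_ _ _ jac] := Hmu.
have E a b c : coordinate p (series_mul mu (const_series (e a))
      (series_mul mu (const_series (e b)) (const_series (e c))) s) =
    \sum_(r < s.+1) \sum_m series_constant b c m r * series_constant a m p (s - r)%N.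
  rewrite series_mul_constl // series_appE (reindex_inj rev_ord_inj) /=.
  rewrite coordinate_bigsum; apply: eq_bigr => r _.
  have le : (r <= s)%N by rewrite -ltnS.
  by rewrite coordinate_bracketr // subSS subKn // series_mul_const.
under eq_bigr do rewrite 2!big_split /=.
by rewrite 2!big_split /= -!E -!coordinateD jac coordinate0.
Qed.

Lemma deformed_word_compatible : compatible scale_series_constant deformed_word.
Proof.
apply: straighten_compatible => /=.
- move=> i k x; rewrite -[RHS](series_scale0 x); congr series_scale.
  by apply/funext => r; rewrite /series_constant /structure_constant mu_alt coordinate0.
- move=> i j k x; rewrite -series_scaleN; congr series_scale.
  apply/funext => r; rewrite /series_constant /structure_constant.
  by rewrite (bracket_anti (mu_bil r) (@mu_alt r)) coordinateN.
- by move=> i j k i' j' k' x; rewrite series_scaleC.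
- move=> i j l p.
  have T c d : tlinear (fun x : nat -> U => series_scale c (series_scale d x)).
    exact: (tlinear_comp (series_scale_tlinear _ c) (series_scale_tlinear _ d)).
  apply: (tlinear_eq (tlinear_sum _ (fun m => tlinearD (tlinearD (T _ _) (T _ _)) (T _ _)))
                     (tlinear0 _ _)) => x s.
  rewrite fct_sumE -[RHS](scale0r x) -(series_jacobi i j l p s).
  rewrite scaler_suml; under [RHS]eq_bigr do rewrite scaler_suml.
  rewrite [RHS]exchange_big; apply: eq_bigr => m _.
  rewrite -[LHS]/(_ s + _ s + _ s) /series_scale !series_app_const2;
    try exact: scale_lin.
  rewrite -!big_split; apply: eq_bigr => r _ /=.
  by rewrite !scalerA -!scalerDl.
Qed.

Lemma deformed_word_nondecreasing w : nondecreasing w ->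
  deformed_word w = const_series (word_prod w).
Proof. exact: straighten_nondecreasing. Qed.

(** Below order q the structure constants are those of [br], so each such coefficient of
    [deformed_word] obeys the undeformed relations and is determined by nondecreasing words. *)
Lemma deformed_word_low q : (forall r x y, (0 < r < q)%N -> mu r x y = 0) ->
  forall r w, (r < q)%N -> deformed_word w r = const_series (word_prod w) r.
Proof.
move=> mu0 r w lt_rq.
have [mu_br _ _ _] := Hmu.
have C : compatible (scale_constant br U) (fun w => deformed_word w r).
  move=> u i j v; have := congr1 (@^~ r) (deformed_word_compatible u i j v).
  rewrite -[LHS]/(_ - _) /contract fct_sumE => ->.
  apply: eq_bigr => k _ /=; rewrite /series_scale series_appE big_ord_recl subn0 /=.
  rewrite big1 ?addr0 => [|s _]; last first.
    rewrite /series_constant /structure_constant mu0 ?coordinate0 ?scale0r //.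
    by rewrite /bump /=; have := ltn_ord s; lia.
  by rewrite /series_constant /structure_constant mu_br.
case: r lt_rq C => [|r] lt_rq C.
  apply: (compatible_eq C (word_prod_compatible HU)) => {}w ws.
  by rewrite deformed_word_nondecreasing.
apply: (@compatible_eq _ _ _ _ (fun=> 0) C) => [u i j v|{}w ws].
  by rewrite /contract subr0 big1 // => k _; rewrite raddf0.
by rewrite deformed_word_nondecreasing.
Qed.

Section Product.
Variable m : nat -> U -> U -> U.
Hypothesis m_bil : forall r, bilinear_map (m r).
Hypothesis mE : forall w w' r, nondecreasing w -> nondecreasing w' ->
  m r (word_prod w) (word_prod w') = deformed_word (w ++ w') r.

(** Both sides are compatible in each word separately, which reduces the identity to nondecreasing
    words, where it is [mE]. *)
Lemma deformed_word_mul w w' :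
  series_mul m (deformed_word w) (deformed_word w') = deformed_word (w ++ w').
Proof.
have catl : compatible scale_series_constant (fun w => deformed_word (w ++ w')).
  move=> u i j v; rewrite -!catA deformed_word_compatible.
  by apply: eq_bigr => k _; rewrite -catA.
have mull : compatible scale_series_constant
    (fun w => series_mul m (deformed_word w) (deformed_word w')).
  have lin := series_mul_linearl m_bil (deformed_word w').
  move=> u i j v; rewrite -(linB lin) deformed_word_compatible (lin_sum lin).
  by apply: eq_bigr => k _; rewrite /= series_mul_scalel.
apply: (compatible_eq mull catl) => {}w ws {catl mull}.
have catr : compatible scale_series_constant (fun w' => deformed_word (w ++ w')).
  move=> u i j v; rewrite !catA deformed_word_compatible.
  by apply: eq_bigr => k _; rewrite catA.
have mulr : compatible scale_series_constant
    (fun w' => series_mul m (deformed_word w) (deformed_word w')).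
  have lin := series_mul_linearr m_bil (deformed_word w).
  move=> u i j v; rewrite -(linB lin) deformed_word_compatible (lin_sum lin).
  by apply: eq_bigr => k _; rewrite /= series_mul_scaler.
apply: (compatible_eq mulr catr) => {}w' ws' {catr mulr}.
apply/funext => r; rewrite (deformed_word_nondecreasing ws) (deformed_word_nondecreasing ws').
by rewrite series_mul_const // mE.
Qed.

(** By K[[t]]-linearity and PBW only nondecreasing words matter, and on words the product is
    concatenation. *)
Lemma deformed_product_assoc a b c :
  series_mul m (series_mul m a b) c = series_mul m a (series_mul m b c).
Proof.
have Tl b' := series_mul_tlinearl m_bil b'.
have Tr a' := series_mul_tlinearr m_bil a'.
have Ll b' := series_mul_linearl m_bil b'.
have Lr a' := series_mul_linearr m_bil a'.
have Lc := @const_series_linear K U.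
apply: (tlinear_eq (tlinear_comp (Tl c) (Tl b)) (Tl (series_mul m b c))) => x s.
congr (_ s); move: {a s} b.
apply: (tlinear_eq (tlinear_comp (Tl c) (Tr _)) (tlinear_comp (Tr _) (Tl c))) => y s.
congr (_ s); move: {s} c.
apply: (tlinear_eq (Tr _) (tlinear_comp (Tr _) (Tr _))) => z s.
congr (_ s) => /= {s}.
move: x; apply: (linear_eq_nondecreasing HU) => [d x x'|d x x'|w ws].
- by rewrite Lc 2!(Ll _).
- by rewrite Lc Ll.
move: y; apply: (linear_eq_nondecreasing HU) => [d y y'|d y y'|w' ws'].
- by rewrite Lc Lr Ll.
- by rewrite Lc Ll Lr.
move: z; apply: (linear_eq_nondecreasing HU) => [d z z'|d z z'|w'' ws''].
- by rewrite Lc Lr.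
- by rewrite Lc !Lr.
by rewrite -!deformed_word_nondecreasing // !deformed_word_mul catA.
Qed.

Lemma deformed_product_low q : (forall r x y, (0 < r < q)%N -> mu r x y = 0) ->
  forall r u v, (r < q)%N -> m r u v = const_series (u * v) r.
Proof.
move=> mu0 r u v lt; have Lc := @const_series_linear K U.
move: u; apply: (linear_eq_nondecreasing HU) => [|d u u'|w ws].
- by have [_] := m_bil r; apply.
- by rewrite mulrDl -scalerAl Lc.
move: v; apply: (linear_eq_nondecreasing HU) => [|d v v'|w' ws'].
- by have [+ _] := m_bil r; apply.
- by rewrite mulrDr -scalerAr Lc.
by rewrite mE // (deformed_word_low mu0) // word_prod_cat.
Qed.

Lemma deformed_product_commutator r x y :
  m r (iota x) (iota y) - m r (iota y) (iota x) = iota (mu r x y).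
Proof.
have [Lr Ll] := m_bil r; have [Mr Ml] := mu_bil r.
move: x; apply: linear_basis_eq => [d x x'|d x x'|i].
- by rewrite iota_lin Ll Lr opprD addrACA scalerBr.
- by rewrite Ml iota_lin.
move: y; apply: linear_basis_eq => [d y y'|d y y'|j].
- by rewrite iota_lin Ll Lr opprD addrACA scalerBr.
- by rewrite Mr iota_lin.
rewrite -!word_prod1 !mE //.
have := congr1 (@^~ r) (deformed_word_compatible [::] i j [::]).
rewrite -[LHS]/(_ - _) /contract fct_sumE => ->.
rewrite [mu r _ _]coordinate_sum (lin_sum iota_lin); apply: eq_bigr => k _ /=.
rewrite deformed_word_nondecreasing // /series_scale series_app_const;
  last exact: scale_lin.
by rewrite word_prod1 (linZ iota_lin).
Qed.

End Product.

Theorem deformed_product q : (0 < q)%N ->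
    (forall r x y, (0 < r < q)%N -> mu r x y = 0) ->
  exists m : nat -> U -> U -> U,
    [/\ assoc_deformation *%R m,
        forall r u v, (0 < r < q)%N -> m r u v = 0 &
        forall r x y,
          m r (iota x) (iota y) - m r (iota y) (iota x) = iota (mu r x y)].
Proof.
move=> q0 mu0.
(* PBW is used twice: in the right factor with values in U[[t]], then in the left factor with values
   in functions from U to U[[t]], whose linearity is recovered afterwards. *)
have [A HA] :=
  choice (fun w => pbw_extension Hbr HU (fun w' => deformed_word (w ++ w'))).
have [H [H_lin HE]] := pbw_extension Hbr HU (A : seq 'I_n -> U -> nat -> U).
have H_linr : forall u, linear (H u).
  apply: (nondecreasing_span HU) => [|w ws]; last by rewrite HE //; case: (HA w).
  split=> [|c u v Hu Hv d x y].
    by rewrite (lin0 H_lin) => d x y; rewrite scaler0 addr0.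
  by rewrite H_lin !addfE !scalefE Hu Hv !scalerDr addrACA !scalerA [d * c]mulrC.
pose m r u v := H u v r.
have m_bil r : bilinear_map (m r).
  by split=> [u|v] c x y; rewrite /m ?H_linr ?H_lin.
have mE w w' r : nondecreasing w -> nondecreasing w' ->
    m r (word_prod w) (word_prod w') = deformed_word (w ++ w') r.
  by move=> ws ws'; rewrite /m HE // (HA w).2.
exists m; split.
- split=> [u v||a b c s]; last by rewrite (deformed_product_assoc m_bil mE).
    by rewrite (deformed_product_low m_bil mE mu0).
  exact: m_bil.
- move=> r u v /andP[r0 lt]; rewrite (deformed_product_low m_bil mE mu0) //.
  by case: r r0 {lt}.
- exact: deformed_product_commutator.
Qed.

End DeformedProduct.

(** * Leading terms are coboundaries *)

Section Euler.
Variables (K : fieldType) (A : lmodType K).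
Implicit Types (mu : nat -> A -> A -> A) (a b : nat -> A).

Definition euler a : nat -> A := fun n => n%:R *: a n.

Lemma euler_linear : linear euler.
Proof.
move=> c a b; apply/funext => n; rewrite /euler !addfE !scalefE.
by rewrite scalerDr !scalerA mulrC.
Qed.

Lemma euler_mul mu a b : (forall r, bilinear_map (mu r)) ->
  euler (series_mul mu a b) = series_mul mu (euler a) b + series_mul mu a (euler b)
    + series_mul (fun r x y => r%:R *: mu r x y) a b.
Proof.
move=> mu_bil; apply/funext => n; rewrite /euler !addfE /series_mul.
rewrite scaler_sumr -!big_split; apply: eq_bigr => i _ /=.
rewrite scaler_sumr -!big_split; apply: eq_bigr => j _ /=.
rewrite scaler_sumr -!big_split; apply: eq_bigr => k /eqP E /=.
have [lr ll] := mu_bil i; rewrite (linZ (ll _)) (linZ (lr _)) -!scalerDl -!natrD.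
by congr (_%:R *: _); lia.
Qed.

(** If i + j + k = n <= q, then i < q unless i = n = q and j = k = 0. The case q = 0 computes
    constant coefficients. *)
Lemma series_mul_low mu a b q : (forall r x y, (r < q)%N -> mu r x y = 0) ->
  forall n, (n <= q)%N ->
    series_mul mu a b n = if n == q then mu q (a 0%N) (b 0%N) else 0.
Proof.
move=> mu0 n le_nq; rewrite /series_mul big_ord_recr /= big1 ?add0r => [|i _]; last first.
  do 2!(rewrite big1 // => ? _); rewrite mu0 //.
  exact: leq_trans (ltn_ord i) le_nq.
rewrite big_ord_recl [X in _ + X]big1 ?addr0 => [|j _]; last first.
  by rewrite big1 // => l /eqP E; move: E; rewrite /= /bump /=; lia.
rewrite (bigD1 ord0) ?addn0 //= big1 ?addr0 => [|l /andP[/eqP E /eqP[]]]; last first.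
  by apply/val_inj => /=; lia.
by case: eqP => [-> //|ne]; rewrite mu0 //; lia.
Qed.

Lemma series_app_linear (phi : nat -> A -> A) : (forall r, linear (phi r)) ->
  linear (series_app phi).
Proof.
move=> lin c a b; apply/funext => n.
rewrite addfE scalefE !series_appE scaler_sumr -big_split; apply: eq_bigr => i _ /=.
by rewrite addfE scalefE lin.
Qed.

End Euler.

Section Trivialization.
Variables (K : fieldType) (U : algType K).

Lemma const_deformation_bilinear r : bilinear_map (constant_deformation ( *%R : U -> U -> U) r).
Proof.
case: r => [|r]; split=> a c x y /=; rewrite ?scaler0 ?addr0 //.
  by rewrite mulrDr scalerAr.
by rewrite mulrDl scalerAl.
Qed.

Lemma const_deformation_mulr (a : nat -> U) y n :
  series_mul (constant_deformation *%R) a (const_series y) n = a n * y.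
Proof.
rewrite series_mul_constr; last exact: const_deformation_bilinear.
by rewrite series_appE big_ord_recl big1 ?addr0 /= ?subn0.
Qed.

Lemma const_deformation_mull (b : nat -> U) x n :
  series_mul (constant_deformation *%R) (const_series x) b n = x * b n.
Proof.
rewrite series_mul_constl; last exact: const_deformation_bilinear.
by rewrite series_appE big_ord_recl big1 ?addr0 /= ?subn0.
Qed.

(* The logarithmic derivative D = Phi^-1 (t d/dt) Phi of a trivialization Phi is
   a derivation up to Phi^-1 (t d/dt mu)(Phi, Phi).  Unlike the usual reduction
   of Phi to the form 1 + t^q phi_q + ... it needs no exponentials. *)
Lemma trivial_deformation_coboundary (m : nat -> U -> U -> U) q : (0 < q)%N ->
  assoc_deformation *%R m -> (forall r u v, (0 < r < q)%N -> m r u v = 0) ->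
  trivial_deformation *%R m ->
  exists D : U -> U, linear D /\
    forall u v, D (u * v) = D u * v + u * D v + q%:R *: m q u v.
Proof.
move=> q0 [m0 m_bil _] m_low [phi [psi [phi0 phi_lin phiK triv]]].
pose Phi := series_app phi; pose c u : nat -> U := const_series u.
have Phi_inj a b : Phi a = Phi b -> a = b by apply: series_app_inj.
have PhiV a : Phi (series_inv phi a) = a by apply: series_invK.
have Phi_lin : linear Phi := series_app_linear phi_lin.
pose cm := series_mul (constant_deformation ( *%R : U -> U -> U)).
have PhiM a b : Phi (cm a b) = series_mul m (Phi a) (Phi b).
  have cm_bil := const_deformation_bilinear.
  have T := series_app_tlinear phi_lin.
  move: a; apply: (tlinear_eq (tlinear_comp T (series_mul_tlinearl cm_bil b))
                     (tlinear_comp (series_mul_tlinearl m_bil _) T)) => x n.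
  congr (_ n); move: b {n}.
  apply: (tlinear_eq (tlinear_comp T (series_mul_tlinearr cm_bil _))
                     (tlinear_comp (series_mul_tlinearr m_bil _) T)) => y n /=.
  have -> : series_mul (constant_deformation *%R) (const_series x) (const_series y)
      = psi (series_mul m (fun n => phi n x) (fun n => phi n y)).
    apply/funext => r; rewrite -triv series_mul_const //.
  have [_ ->] := phiK (series_mul m (fun n => phi n x) (fun n => phi n y)).
  by congr (series_mul m _ _ n); apply/funext => r; rewrite series_app_const.
pose D u := series_inv phi (euler (Phi (c u))).
have D_lin : linear D.
  move=> d u v; apply: Phi_inj; rewrite Phi_lin !PhiV.
  by rewrite /c const_series_linear Phi_lin euler_linear.
have PhiD u : Phi (D u) = euler (Phi (c u)) by apply: PhiV.
pose Z u v := series_mul (fun r x y => r%:R *: m r x y) (Phi (c u)) (Phi (c v)).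
(* Apply t d/dt to Phi(u v) = m_t(Phi u, Phi v) and pull back by Phi. *)
have DM u v : D (u * v) = cm (D u) (c v) + cm (c u) (D v) + series_inv phi (Z u v).
  apply: Phi_inj; rewrite (linD Phi_lin (cm _ _ + _)) (linD Phi_lin (cm _ _)).
  rewrite !PhiM PhiV !PhiD.
  have -> : c (u * v) = cm (c u) (c v).
    by apply/funext => r; rewrite /cm const_deformation_mulr; case: r => //= r; rewrite mul0r.
  by rewrite PhiM euler_mul.
exists (fun u => D u q); split=> [d u v|u v]; first by rewrite D_lin.
rewrite DM -[LHS]/(_ q + _ q + _ q) /cm const_deformation_mulr const_deformation_mull.
congr (_ + _).
(* Order 0 disappears through the factor r, the orders between 0 and q through [m_low]; so Z starts
   at t^q and Phi^-1 keeps its leading coefficient. *)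
have m_low' r x y : (r < q)%N -> r%:R *: m r x y = 0.
  by case: r => [|r] lt; rewrite ?scale0r // m_low ?scaler0.
have Zlow := series_mul_low (Phi (c u)) (Phi (c v)) m_low'.
have inv_low r : (r < q)%N -> series_inv phi (Z u v) r = 0.
  apply: (series_app_inj_upto phi0 (b := 0)) => {}r lt.
  rewrite -/(Phi _) PhiV -/(Phi 0) (lin0 Phi_lin) /Z Zlow; last exact: ltnW.
  by rewrite ltn_eqF.
have := congr1 (@^~ q) (PhiV (Z u v)); rewrite /= /Phi series_app_recl //.
rewrite big1 ?addr0 => [->|i _]; last first.
  by rewrite inv_low ?(lin0 (phi_lin _)) //; lia.
rewrite /Z Zlow // eqxx; by rewrite /Phi /c !series_app_const // !phi0.
Qed.

End Trivialization.

Section Core.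
Variables (K : fieldType) (char0 : [pchar K] =i pred0).
Variables (g : vectType K) (br : g -> g -> g) (Hbr : lie_bracket br).

Lemma leading_term_coboundary (mu : nat -> g -> g -> g) q : (0 < q)%N ->
  strongly_rigid br -> lie_deformation br mu ->
  (forall r x y, (0 < r < q)%N -> mu r x y = 0) ->
  exists f : g -> g, linear f /\
    forall x y, mu q x y = br (f x) y + br x (f y) - f (br x y).
Proof.
move=> q0 [U [iota [HU rig]]] Hmu mu_low.
have [[br_r br_l] br_alt _] := Hbr; have [[iota_lin iota_br] _] := HU.
have [m [m_def m_low m_comm]] := deformed_product Hbr HU Hmu q0 mu_low.
have [D [D_lin DM]] := trivial_deformation_coboundary q0 m_def m_low (rig _ m_def).
(* A finite basis of g bounds the degree of D on all of g at once. *)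
have [d Hd] : exists d, forall x, filtration iota d (D (iota x)).
  have [dd Hdd] := choice (fun i => filtration_exhaust HU (D (iota (basis_vec i)))).
  exists (\max_i dd i) => x.
  have sub := filtration_subspace iota (\max_i dd i).
  rewrite [x]coordinate_sum (lin_sum iota_lin) (lin_sum D_lin).
  apply: (subspace_sum sub) => i; rewrite (linZ iota_lin) (linZ D_lin).
  by apply: (subspaceZ sub); apply: filtration_le (Hdd i); apply: leq_bigmax.
have [p [p_lin p_ad p_iota p_range]] := equivariant_retraction HU char0 d.
have [f fE] := choice (fun x => p_range _ (Hd x)).
have inj := iota_injective Hbr HU.
have f_lin : linear f.
  by move=> c x y; apply: inj; rewrite iota_lin -!fE iota_lin D_lin p_lin.
have E x y : q%:R *: mu q x y = f (br x y) - br (f x) y - br x (f y).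
  apply: inj; rewrite (linZ iota_lin) !(linB iota_lin) !iota_br -!fE.
  (* Antisymmetrize the formula for D in x and y: the Leibniz terms pair into commutators. *)
  have H : q%:R *: iota (mu q x y) = D (iota (br x y))
      + (iota y * D (iota x) - D (iota x) * iota y)
      - (iota x * D (iota y) - D (iota y) * iota x).
    rewrite iota_br (linB D_lin) !DM -m_comm scalerBr.
    set X := iota x; set Y := iota y; set a := D X * Y; set b := X * D Y.
    set a' := Y * D X; set b' := D Y * X; set s := _ *: _; set t := _ *: _.
    rewrite !opprD opprK.
    rewrite [RHS](AC ((3*3)*2*2) ((3*6)*(1*8)*(2*9)*(10*4)*(7*5))).
    by rewrite /= !subrr !addr0.
  rewrite -[iota (mu q x y)]p_iota -(linZ p_lin) H (linB p_lin) (linD p_lin) !p_ad.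
  by rewrite !opprB.
have qK : q%:R != 0 :> K by rewrite (pcharf0P K).1 // -lt0n.
exists (fun x => - (q%:R^-1 *: f x)); split.
  by move=> c x y; rewrite f_lin scalerDr opprD !scalerA mulrC -scalerA scalerN.
move=> x y; rewrite (linN (br_l _)) (linN (br_r _)) (linZ (br_l _)) (linZ (br_r _)).
rewrite opprK -!scalerN -!scalerDr [X in _ *: X](_ : _ = q%:R *: mu q x y).
  by rewrite scalerA mulVf ?scale1r.
by rewrite E [RHS](AC (2*1) (2*3*1)).
Qed.

End Core.

(** * Trivialization order by order *)

Lemma iter_shiftE (A : zmodType) k (a : nat -> A) n :
  iter k (@shift_series A) a n = if (k <= n)%N then a (n - k)%N else 0.
Proof. by elim: k n => [|k IH] [|n] //=; rewrite ?subn0 // IH subSS. Qed.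

Lemma tlinear_iter_shift (A B : zmodType) (F : (nat -> A) -> nat -> B) k a :
  tlinear F -> F (iter k (@shift_series A) a) = iter k (@shift_series B) (F a).
Proof. by move=> [_ Fs]; elim: k => //= k <-. Qed.

(** * Transport of a deformation along a series of linear maps *)

Section Conjugation.
Variables (K : fieldType) (A : lmodType K) (br : A -> A -> A).
Variables (mu : nat -> A -> A -> A) (Hmu : lie_deformation br mu).
Variables (alpha : nat -> A -> A).
Hypothesis alpha0 : alpha 0%N =1 id.
Hypothesis alpha_lin : forall r, linear (alpha r).

Let mu_bil r : bilinear_map (mu r). Proof. by case: Hmu => _ /(_ r) []. Qed.

Definition conjugate_deformation : nat -> A -> A -> A := fun n x y =>
  series_inv alpha (series_mul mu (alpha ^~ x) (alpha ^~ y)) n.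

Lemma alpha_const x : series_app alpha (const_series x) = alpha ^~ x.
Proof. by apply/funext => n; rewrite series_app_const. Qed.

Lemma conjugateK x y :
  series_app alpha (conjugate_deformation ^~ x ^~ y) =
  series_mul mu (alpha ^~ x) (alpha ^~ y).
Proof. exact: series_invK. Qed.

Lemma conjugate_bilinear r : bilinear_map (conjugate_deformation r).
Proof.
have inv_lin : linear (series_inv alpha).
  move=> c a b; apply: (series_app_inj alpha0).
  by rewrite (series_app_linear alpha_lin) !series_invK.
split=> [x|y] c z z'; rewrite /conjugate_deformation.
  have -> : alpha ^~ (c *: z + z') = c *: (alpha ^~ z) + (alpha ^~ z').
    by apply/funext => n; rewrite alpha_lin.
  by rewrite (series_mul_linearr mu_bil) inv_lin.
have -> : alpha ^~ (c *: z + z') = c *: (alpha ^~ z) + (alpha ^~ z').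
  by apply/funext => n; rewrite alpha_lin.
by rewrite (series_mul_linearl mu_bil) inv_lin.
Qed.

Lemma series_mul_conjugate a b : series_mul conjugate_deformation a b =
  series_inv alpha (series_mul mu (series_app alpha a) (series_app alpha b)).
Proof.
have T := series_app_tlinear alpha_lin.
have T' := series_inv_tlinear alpha0 alpha_lin.
have Cb := conjugate_bilinear.
move: a; apply: (tlinear_eq (series_mul_tlinearl Cb b)
  (tlinear_comp T' (tlinear_comp (series_mul_tlinearl mu_bil _) T))) => x n.
congr (_ n); move: b {n}; apply: (tlinear_eq (series_mul_tlinearr Cb _)
  (tlinear_comp T' (tlinear_comp (series_mul_tlinearr mu_bil _) T))) => y n.
by rewrite series_mul_const //= !alpha_const.
Qed.

Lemma conjugate_lie_deformation : lie_deformation br conjugate_deformation.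
Proof.
have [mu_br mu_alt alt jac] := Hmu.
have [invD _] := series_inv_tlinear alpha0 alpha_lin.
have inv0 : series_inv alpha 0 = 0.
  by apply: (addrI (series_inv alpha 0)); rewrite -invD !addr0.
have alt0 a : series_mul mu a a = 0 by apply/funext => n; apply: alt.
split.
- move=> x y; rewrite /conjugate_deformation /series_inv /= big_ord0 subr0.
  by rewrite (@series_mul_low _ _ _ _ _ 0) //= !alpha0 mu_br.
- move=> r; split; first exact: conjugate_bilinear.
  by move=> x; rewrite /conjugate_deformation alt0 inv0.
- by move=> a n; rewrite series_mul_conjugate alt0 inv0.
- move=> a b c n; rewrite !series_mul_conjugate !series_invK //.
  set x := series_mul mu _ _; set y := series_mul mu _ _; set z := series_mul mu _ _.
  have -> : series_inv alpha x n + series_inv alpha y n + series_inv alpha z n =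
    series_inv alpha (x + y + z) n by rewrite !invD.
  have -> : x + y + z = 0 by apply/funext => r; apply: jac.
  by rewrite inv0.
Qed.

End Conjugation.

Section Rigidity.
Variables (K : fieldType) (char0 : [pchar K] =i pred0).
Variables (g : vectType K) (br : g -> g -> g) (Hbr : lie_bracket br).
Hypothesis rigid : strongly_rigid br.
Variables (mu : nat -> g -> g -> g) (Hmu : lie_deformation br mu).

Let mu_bil r : bilinear_map (mu r). Proof. by case: Hmu => _ /(_ r) []. Qed.

Definition intertwines_at n (alpha : nat -> g -> g) := forall x y,
  alpha n (br x y) = series_mul mu (alpha ^~ x) (alpha ^~ y) n.

Definition trivializes_upto k (alpha : nat -> g -> g) :=
  [/\ alpha 0%N =1 id, forall r, linear (alpha r) &
      forall n, (n < k)%N -> intertwines_at n alpha].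

Lemma intertwines_local n alpha alpha' :
  (forall r, (r <= n)%N -> alpha r = alpha' r) ->
  intertwines_at n alpha -> intertwines_at n alpha'.
Proof.
move=> E H x y; rewrite -E // H; apply: eq_bigr => i _; apply: eq_bigr => j _.
by apply: eq_bigr => k _; rewrite !E // -ltnS.
Qed.

(** Composing alpha with 1 - t^k h removes the leading term of the conjugate. Modulo t^(k+1) this
    subtracts h from coefficient k, and only that coefficient is changed, so the steps have a
    coefficientwise limit. *)
Lemma trivialization_step k alpha : (0 < k)%N -> trivializes_upto k alpha ->
  exists alpha', trivializes_upto k.+1 alpha' /\
    forall n, (n < k)%N -> alpha' n = alpha n.
Proof.
move=> k0 [alpha0 alpha_lin EQ]; have [mu_br _ _ _] := Hmu.
pose nu := conjugate_deformation mu alpha.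
have Hnu : lie_deformation br nu := conjugate_lie_deformation Hmu alpha0 alpha_lin.
have nuK x y : series_app alpha (fun n => nu n x y) =
    series_mul mu (alpha ^~ x) (alpha ^~ y) := conjugateK mu alpha0 alpha_lin x y.
have nu_const x y n : (n < k)%N -> nu n x y = const_series (br x y) n.
  apply: (series_app_inj_upto alpha0 (a := fun n => nu n x y)) => {}n lt.
  by rewrite nuK -EQ // series_app_const.
have nu_low r x y : (0 < r < k)%N -> nu r x y = 0.
  by move=> /andP[r0 lt]; rewrite nu_const //; case: r r0 {lt}.
have nu_k x y : series_mul mu (alpha ^~ x) (alpha ^~ y) k = alpha k (br x y) + nu k x y.
  rewrite -nuK series_app_recl // addrC; congr (_ + _).
  case: (k) k0 nu_const => // k' _ nu_const.
  rewrite big_ord_recr /= big1 ?add0r ?subnn => [|i _]; first by rewrite nu_const.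
  rewrite nu_const; last by lia.
  have := ltn_ord i; case E : (k'.+1 - i.+1)%N => [|r] /= lt; first by lia.
  by rewrite (lin0 (alpha_lin _)).
have [h [h_lin hE]] := leading_term_coboundary char0 Hbr k0 rigid Hnu nu_low.
pose alpha' r x := if r == k then alpha r x - h x else alpha r x.
have alpha'E r : (r < k)%N -> alpha' r = alpha r.
  by move=> lt; apply/funext => x; rewrite /alpha' ltn_eqF.
exists alpha'; split=> //; split.
- by move=> x; rewrite alpha'E.
- move=> r c x y; rewrite /alpha'; case: eqP => _; rewrite alpha_lin // h_lin.
  by rewrite opprD addrACA scalerBr.
move=> n; rewrite ltnS leq_eqVlt => /orP[/eqP->|lt]; last first.
  apply: intertwines_local (EQ _ lt) => r le.
  by rewrite alpha'E //; apply: leq_ltn_trans le lt.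
move=> x y.
pose delta z : nat -> g := iter k (@shift_series g) (const_series z).
have E z : alpha' ^~ z = alpha ^~ z + delta (- h z).
  apply/funext => r; rewrite addfE /delta iter_shiftE /alpha'.
  case: (ltngtP k r) => [lt|lt|<-]; rewrite ?addr0 ?subnn //.
  by rewrite -(subnSK lt) /= addr0.
have Dl z (b : nat -> g) : series_mul mu (delta z) b k = br z (b 0%N).
  rewrite (tlinear_iter_shift _ _ (series_mul_tlinearl mu_bil b)) iter_shiftE leqnn subnn.
  by rewrite (@series_mul_low _ _ _ _ _ 0) //= mu_br.
have Dr z (a : nat -> g) : series_mul mu a (delta z) k = br (a 0%N) z.
  rewrite (tlinear_iter_shift _ _ (series_mul_tlinearr mu_bil a)) iter_shiftE leqnn subnn.
  by rewrite (@series_mul_low _ _ _ _ _ 0) //= mu_br.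
(* The term quadratic in the correction has order 2k and misses t^k, as k > 0. *)
rewrite !E (linD (series_mul_linearl mu_bil _)) !(linD (series_mul_linearr mu_bil _)).
have [[br_r br_l] _ _] := Hbr.
rewrite !addfE Dl Dr Dl nu_k hE !alpha0 /delta iter_shiftE leqNgt k0 /=.
rewrite (linN (br_r _)) !(linN (br_l _)) (lin0 (br_r _)) oppr0 addr0.
rewrite /alpha' eqxx [RHS](AC ((1*3)*1*1) ((1*4)*(2*6)*(3*5))) /=.
by rewrite !subrr !addr0.
Qed.

Theorem strongly_rigid_trivial : trivial_deformation br mu.
Proof.
pose init r (x : g) : g := if r is 0 then x else 0.
have init1 : trivializes_upto 1 init.
  split=> // [[|r] c x y|[|n] // _ x y] //=; first by rewrite scaler0 addr0.
  rewrite (@series_mul_low _ _ _ _ _ 0) //=.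
  by case: Hmu => ->.
(* The default [init] outside the hypothesis makes the relation total, so that choice supplies a
   step function. *)
have total (ka : nat * (nat -> g -> g)) : exists alpha',
    trivializes_upto ka.1.+1 ka.2 -> trivializes_upto ka.1.+2 alpha' /\
      forall n, (n < ka.1.+1)%N -> alpha' n = ka.2 n.
  case: (pselect (trivializes_upto ka.1.+1 ka.2)) => [H|nH]; last by exists init.
  by have [alpha' H'] := trivialization_step (ltn0Sn _) H; exists alpha'.
have [next nextP] := choice total.
pose a := fix a k := if k is k'.+1 then next (k', a k') else init.
have aP k : trivializes_upto k.+1 (a k).
  by elim: k => [|k IH] //=; case: (nextP (k, a k) IH).
have aS k n : (n <= k)%N -> a k.+1 n = a k n.
  by move=> le; case: (nextP (k, a k) (aP k)) => _; apply.
have a_stable k n : (n <= k)%N -> a k n = a n n.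
  move/subnK <-; elim: (k - n)%N => // d IH; rewrite addSn aS ?IH //.
  exact: leq_addl.
(* Coefficient n is final from stage n on, so the diagonal is the limit. *)
pose alpha n := a n n.
have alpha0 : alpha 0%N =1 id by [].
have alpha_lin r : linear (alpha r) by have [_ + _] := aP r; apply.
exists alpha, (series_inv alpha); split=> // [c|x y n].
  by split=> n; rewrite ?series_appK ?series_invK.
have -> : series_mul mu (alpha ^~ x) (alpha ^~ y) =
    series_app alpha (const_series (br x y)).
  apply/funext => r; rewrite series_app_const //.
  have [_ _ /(_ r (ltnSn r)) H] := aP r.
  symmetry; move: x y; apply: intertwines_local H => s le.
  exact: a_stable.
by rewrite series_appK //; case: n.
Qed.

End Rigidity.

Theorem mainTheorem2 (K : closedFieldType) (char0 : [pchar K]%R =i pred0)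
    (g : vectType K) (br : g -> g -> g) (Hbr : lie_bracket br) :
  strongly_rigid br -> lie_rigid br.
Proof. by move=> rigid mu Hmu; apply: (strongly_rigid_trivial char0 Hbr rigid Hmu). Qed.
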